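(* Let $A$ and $B$ be $F$-multiplicity-free skew shapes of the same size. Then $\mathrm{supp}_F(A) \supseteq \mathrm{supp}_F(B)$ if and only if $\mathrm{rows}_k(A) \preceq \mathrm{rows}_k(B)$ for all $k\ge 1$.
   Context: A composition of $n$ is a sequence of positive integers with sum $n$; a partition is a weakly decreasing composition. Compositions $\alpha=(\alpha_1,\dots,\alpha_k)$ of $n$ correspond bijectively to subsets of $[n-1]=\{1,\dots,n-1\}$ via $S(\alpha)=\{\alpha_1,\alpha_1+\alpha_2,\dots,\alpha_1+\cdots+\alpha_{k-1}\}$. Young diagrams are left-justified with row $1$ at the top; a skew shape $\lambda/\mu$ is the Young diagram of $\lambda$ with the boxes of $\mu\subseteq\lambda$ removed from its top-left. The size of a skew shape is its number of boxes. A standard Young tableau (SYT) of a skew shape $A$ with $n$ boxes is a filling of the boxes by $1,\dots,n$, each used once, increasing left to right along rows and down columns. Its descent set is the set of $i$ such that $i+1$ appears in a strictly lower row than $i$, and its descent composition is the composition of $n$ corresponding to its descent set. The monomial quasisymmetric functions are $M_\alpha=\sum_{i_1<\cdots<i_k}x_{i_1}^{\alpha_1}\cdots x_{i_k}^{\alpha_k}$, and the fundamental quasisymmetric functions are $F_\alpha=\sum_{S(\alpha)\subseteq S(\beta)\subseteq[n-1]}M_\beta$ for $\alpha$ of size $n$; they form a basis of the quasisymmetric functions. The skew Schur function is $s_A=\sum_T F_{\mathrm{comp}(T)}$, the sum being over all SYT $T$ of shape $A$, where $\mathrm{comp}(T)$ is the descent composition of $T$. The $F$-support $\mathrm{supp}_F(A)$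 is the set of compositions $\alpha$ such that $F_\alpha$ has positive coefficient in $s_A$. A skew shape $A$ is $F$-multiplicity-free if all coefficients in the $F$-expansion of $s_A$ are $0$ or $1$ (equivalently, all SYT of shape $A$ have distinct descent sets). For a skew shape $A$ with $r$ rows and $1\le i\le r-k+1$, let $\mathrm{overlap}_k(i)$ be the number of columns occupied in common by rows $i,i+1,\dots,i+k-1$; $\mathrm{rows}_k(A)$ is the partition obtained by sorting $(\mathrm{overlap}_k(1),\dots,\mathrm{overlap}_k(r-k+1))$ into weakly decreasing order and omitting zeros (so it is the empty partition if there are no nonzero overlaps). Dominance order, for partitions possibly of different sizes: $\lambda=(\lambda_1,\dots,\lambda_r)\preceq\mu=(\mu_1,\dots,\mu_s)$ if $\lambda_1+\cdots+\lambda_k\le\mu_1+\cdots+\mu_k$ for all $k=1,\dots,r$, where $\mu_i=0$ for $i>s$. *)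

(* Defs.v *)
From HB Require Import structures.
From mathcomp Require Import all_boot all_order all_algebra finmap.

Set Implicit Arguments.
Unset Strict Implicit.
Unset Printing Implicit Defensive.

Local Open Scope nat_scope.

Record composition (n : nat) := Composition {
  parts :> seq nat;
  _ : (0 \notin parts) && (sumn parts == n) }.

HB.instance Definition _ n := [isSub for @parts n].
HB.instance Definition _ n := [Choice of composition n by <:].

Lemma leq_sumn (s : seq nat) x : x \in s -> x <= sumn s.
Proof.
elim: s => //= y s IHs; rewrite inE => /predU1P[-> | /IHs le_xs].
  exact: leq_addr.
exact: leq_trans le_xs (leq_addl _ _).
Qed.

Lemma size_le_sumn (s : seq nat) : 0 \notin s -> size s <= sumn s.
Proof.
elim: s => //= x s IHs; rewrite inE negb_or eq_sym -lt0n => /andP[x_gt0 /IHs].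
by move=> le_s; rewrite -add1n leq_add.
Qed.

Definition composition_code n (a : composition n) : n.-bseq 'I_n.+1 :=
  insub_bseq n (map inord a).
Definition composition_decode n (b : n.-bseq 'I_n.+1) : option (composition n) :=
  insub (map val b).

Lemma composition_codeK n :
  pcancel (@composition_code n) (@composition_decode n).
Proof.
move=> a; have /andP[a0 /eqP an] := valP a.
rewrite /composition_decode /composition_code /insub_bseq insubdK; last first.
  by rewrite -topredE /= size_map -{2}an size_le_sumn.
rewrite -map_comp map_id_in ?valK // => x xa /=.
by rewrite inordK // ltnS -an leq_sumn.
Qed.

HB.instance Definition _ n :=
  Countable.copy (composition n) (pcan_type (@composition_codeK n)).
HB.instance Definition _ n : isFinite (composition n) :=
  PCanIsFinite (@composition_codeK n).

(* Subsets of [n-1] are the sets of type {set 'I_n} that do not contain 0.    *)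
Definition comp_set n (a : composition n) : {set 'I_n} :=
  [set i : 'I_n |
    (i : nat) \in [seq sumn (take j a) | j <- iota 1 (size a).-1]].

(* The sequence of successive differences 0 < d_1 < ... < d_k < n; filtering  *)
(* out zeros only matters when n = 0 or 0 \in D.                              *)
Definition set_parts n (D : {set 'I_n}) : seq nat :=
  [seq d <- pairmap (fun x y => y - x) 0 (rcons (map val (enum D)) n) | 0 < d].

Lemma sumn_pairmap x (s : seq nat) :
  path leq x s -> x + sumn (pairmap (fun y z => z - y) x s) = last x s.
Proof.
elim: s x => [|y s IHs] x /=; first by rewrite addn0.
by case/andP=> le_xy /IHs <-; rewrite addnA subnKC.
Qed.

Lemma sumn_filter_gt0 (s : seq nat) : sumn [seq d <- s | 0 < d] = sumn s.
Proof. by elim: s => //= -[|d] s IHs; rewrite /= IHs. Qed.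

Lemma sorted_val_enum n (D : {set 'I_n}) : sorted ltn (map val (enum D)).
Proof.
apply: (subseq_sorted ltn_trans _ (iota_ltn_sorted 0 n)).
by rewrite -val_enum_ord map_subseq // (enumT (ordinal n)) filter_subseq.
Qed.

Lemma path_val_enum n (D : {set 'I_n}) :
  path leq 0 (rcons (map val (enum D)) n).
Proof.
have le_n : all (fun x => x <= n) (map val (enum D)).
  by apply/allP=> _ /mapP[i _ ->] /=; exact: (ltnW (ltn_ord i)).
rewrite rcons_path path_min_sorted; last exact/allP.
rewrite (sub_sorted _ (sorted_val_enum D)) => [/=|x y /ltnW //].
by case/lastP: (map _ _) le_n => // s x; rewrite last_rcons all_rcons => /andP[].
Qed.

Lemma set_parts_subproof n (D : {set 'I_n}) :
  (0 \notin set_parts D) && (sumn (set_parts D) == n).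
Proof.
rewrite mem_filter sumn_filter_gt0 /=.
by have := sumn_pairmap (path_val_enum D); rewrite add0n last_rcons => ->.
Qed.

Definition set_comp n (D : {set 'I_n}) : composition n :=
  Composition (set_parts_subproof D).

Lemma partial_sums_pairmap x (s : seq nat) : path leq x s ->
  [seq x + sumn (take j (pairmap (fun y z => z - y) x s)) | j <- iota 1 (size s)]
    = s.
Proof.
elim: s x => [|y s IHs] x //= /andP[le_xy le_ys].
rewrite take0 /= addn0 subnKC //; congr (_ :: _).
rewrite -[RHS](IHs y le_ys) (iotaDl 1 1) -map_comp.
by apply: eq_map => j /=; rewrite addnA subnKC.
Qed.

Lemma set_compK n (D : {set 'I_n}) :
  (forall i : 'I_n, i \in D -> 0 < i) -> comp_set (set_comp D) = D.
Proof.
move=> D_gt0; have le_p := path_val_enum D.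
case: n => [|n] in D D_gt0 le_p *; first by apply/setP=> -[].
have gt0_p : path ltn 0 (rcons (map val (enum D)) n.+1).
  rewrite (path_sortedE ltn_trans) all_rcons /=; apply/andP; split.
    by apply/allP=> _ /mapP[i + ->]; rewrite mem_enum => /D_gt0.
  have := sorted_val_enum D; case: (enum D) => //= i s; rewrite rcons_path => ->.
  by rewrite (last_map val s i) /=; apply: ltn_ord.
have pos x s : path ltn x s ->
    all (fun d => 0 < d) (pairmap (fun y z => z - y) x s).
  by elim: s x => //= y s IHs x /andP[lt_xy /IHs ->]; rewrite subn_gt0 lt_xy.
apply/setP=> i; rewrite inE /= /set_parts (all_filterP (pos _ _ gt0_p)).
rewrite size_pairmap size_rcons /=.
have := partial_sums_pairmap le_p.
rewrite size_rcons -(addn1 (size _)) iotaD map_cat /= cats1 => /rcons_inj[-> _].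
by rewrite (mem_map val_inj) mem_enum.
Qed.

(* A monomial x^m in the variables x_0, x_1, ... is given by its finitely     *)
(* supported exponent vector m, and a power series by its coefficients.       *)
Definition monomial := {fsfun nat -> nat with 0}.
Definition power_series := monomial -> int.

Definition exponents (m : monomial) : seq nat :=
  [seq m i | i <- sort leq (finsupp m)].

(* x^m occurs in M_a, with coefficient 1, iff a is the sequence of nonzero    *)
(* exponents of m, listed by increasing index of the variables.               *)
Definition monomial_qsym n (a : composition n) : power_series :=
  fun m => ((exponents m == a)%:R)%R.

Definition fundamental_qsym n (a : composition n) : power_series :=
  fun m => (\sum_(b : composition n | comp_set a \subset comp_set b)
              monomial_qsym b m)%R.

(* Box (i, j) is in row i and column j, both counted from 0, with row 0 at    *)
(* the top.                                                                   *)
Definition skew_boxes (lambda mu : seq nat) : seq (nat * nat) :=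
  [seq (i, j) | i <- iota 0 (size lambda),
                j <- iota (nth 0 mu i) (nth 0 lambda i - nth 0 mu i)].

Definition is_partition (lambda : seq nat) : bool :=
  (0 \notin lambda) && sorted geq lambda.

Record skew_shape (n : nat) := SkewShape {
  outer : seq nat;
  inner : seq nat;
  outer_partition : is_partition outer;
  inner_partition : is_partition inner;
  inner_sub_outer : forall i, nth 0 inner i <= nth 0 outer i;
  size_skew : size (skew_boxes outer inner) = n }.

Definition boxes n (A : skew_shape n) : seq (nat * nat) :=
  skew_boxes (outer A) (inner A).

Definition box n (A : skew_shape n) : finType := seq_sub (boxes A).

Definition box_row n (A : skew_shape n) (b : box A) : nat := (ssval b).1.
Definition box_col n (A : skew_shape n) (b : box A) : nat := (ssval b).2.

Definition filling n (A : skew_shape n) : finType := {ffun box A -> 'I_n.+1}.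

(* As A has n boxes, an injective filling by 1, ..., n uses each number once. *)
Definition is_SYT n (A : skew_shape n) (T : filling A) : bool :=
  [&& [forall b, 0 < T b],
      injectiveb T,
      [forall b, forall b',
         (box_row b == box_row b') && (box_col b < box_col b') ==> (T b < T b')]
    & [forall b, forall b',
         (box_col b == box_col b') && (box_row b < box_row b') ==> (T b < T b')]].

Definition descent_set n (A : skew_shape n) (T : filling A) : {set 'I_n} :=
  [set i : 'I_n | [exists b, exists b',
    [&& T b == i :> nat, T b' == i.+1 :> nat & box_row b < box_row b']]].

Definition descent_comp n (A : skew_shape n) (T : filling A) : composition n :=
  set_comp (descent_set T).

Definition skew_schur n (A : skew_shape n) : power_series :=
  fun m => (\sum_(T : filling A | is_SYT T)
              fundamental_qsym (descent_comp T) m)%R.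

(* The F_a form a basis, so a given f has at most one F-expansion; if f is    *)
(* homogeneous of degree n, it involves only compositions of n.               *)
Definition F_expansion n (f : power_series) (c : composition n -> int) : Prop :=
  forall m, f m = (\sum_(a : composition n) c a * fundamental_qsym a m)%R.

Definition F_support n (A : skew_shape n) (a : composition n) : Prop :=
  exists2 c, F_expansion (skew_schur A) c & (0 < c a)%R.

Definition F_multiplicity_free n (A : skew_shape n) : Prop :=
  exists2 c : composition n -> int, F_expansion (skew_schur A) c
    & forall a, c a = 0%R \/ c a = 1%R.

(* Rows are counted from 0, so overlap k i is defined for i <= r - k, where r *)
(* is the number of rows.                                                     *)
Definition overlap n (A : skew_shape n) (k i : nat) : nat :=
  count (fun j => all (fun i' => (i', j) \in boxes A) (iota i k))
        (iota 0 (nth 0 (outer A) 0)).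

Definition rows n (A : skew_shape n) (k : nat) : seq nat :=
  sort geq [seq x <- [seq overlap A k i | i <- iota 0 ((size (outer A)).+1 - k)]
           | 0 < x].

Definition dominated (lambda mu : seq nat) : Prop :=
  forall k, 1 <= k <= size lambda -> sumn (take k lambda) <= sumn (take k mu).

(* Main.v *)
(** Words are the linear extensions of the set of boxes, read in the order of the
entries of a tableau, and [pat] records the descents of a word as a bit list.

If supports are contained: a word whose first v letters avoid D^k N^l (D a descent,
N an ascent) as a subsequence of the descent pattern cannot contain the lower
right corner of a (k+1) x (l+1) rectangle among them, and reading k times the top
boxes of all columns and then l times the left boxes of all rows uses exactly the
other boxes. So the supports determine the number [rc k l] of such rectangles,
hence the sums of (x - l)^+ over the parts x of rows_(k+1), and comparing these
sums for all l is the dominance order.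

Conversely, two arrangements of a small convex window with equal descents show
that a multiplicity-free shape is, up to transposition and rotation, a hook, a row
and a column side by side, (m,2), (3,3) or (4,4).  For shapes without 2 x 2 square
the support consists of all descent sets allowed by the rectangle numbers; the
few remaining shapes are separated by these numbers. *)
Require Import Defs.
From mathcomp Require Import all_boot all_order all_algebra finmap zify.

Set Implicit Arguments.
Unset Strict Implicit.
Unset Printing Implicit Defensive.

Import GRing.Theory Num.Theory.

Local Open Scope nat_scope.

(** * Words and windows *)

(** The skew shape is replaced by a finite convex set of cells, a notion that survives
    transposition, rotation and removal of boxes without any partition being rebuilt. The letters D
    and N enter through a discrete intermediate value property: between a letter and a later one in
    a lower row some step is a descent, and between a letter and a later one in the same row some
    step is not. Walking down the left side of a rectangle and then along its bottom therefore
    spells D^k N^l in every word. The obstacle is the converse, because these bounds say nothing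
    about how to build a word. In a hook, or in a row and a column side by side, one of the two
    letters at each step decides by its arm whether the step is a descent, so the pattern itself
    dictates a shuffle of the two arms; one end letter remains free, and the bounds for single rows
    and columns show that a suitable choice exists. With a 2 x 2 square no such rule is available.
    There the rectangle numbers are used instead to force [B] into the same two rows (or columns) as
    [A], where patterns can be listed or the shapes agree up to translation. *)

Definition cell : Type := nat * nat.

Definition ble (x y : cell) : bool := (x.1 <= y.1) && (x.2 <= y.2).
Definition below (x y : cell) : bool := x.1 < y.1.

Definition convex (S : seq cell) : Prop :=
  forall x y z, x \in S -> y \in S -> ble x z -> ble z y -> z \in S.

(** As [ble] is reflexive, a word with a repeated box is rejected as well. *)
Definition linear (w : seq cell) : bool := pairwise (fun x y => ~~ ble y x) w.
Definition linext (S w : seq cell) : bool := perm_eq w S && linear w.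

(** The relation is a parameter because on thin shapes patterns are computed by comparing contents
    instead of rows. *)
Definition steps (d : rel cell) (w : seq cell) : seq bool :=
  if w is x :: w' then pairmap d x w' else [::].
Definition pat : seq cell -> seq bool := steps below.

Definition mfree (S : seq cell) : Prop :=
  forall w w', linext S w -> linext S w' -> pat w = pat w' -> w = w'.
Definition occurs (S : seq cell) (p : seq bool) : Prop :=
  exists2 w, linext S w & pat w = p.

Lemma ble_refl x : ble x x.
Proof. by rewrite /ble !leqnn. Qed.

Lemma ble_trans x y z : ble x y -> ble y z -> ble x z.
Proof. rewrite /ble => h1 h2; lia. Qed.

Lemma linear_uniq w : linear w -> uniq w.
Proof.
rewrite uniq_pairwise; apply: sub_pairwise => x y.
by apply: contraNneq => ->; exact: ble_refl.
Qed.

Lemma linear_arrangement (S : seq cell) :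
  uniq S -> exists2 w, perm_eq w S & linear w.
Proof.
move=> uS; pose r := relpre (fun x : cell => x.1 + x.2) leq.
have r_tr : transitive r by move=> y x z; exact: leq_trans.
exists (sort r S); first by rewrite perm_sort.
have : pairwise (fun x y => (x != y) && r x y) (sort r S).
  rewrite pairwise_relI -uniq_pairwise sort_uniq uS -sorted_pairwise //.
  by apply: sort_sorted => x y; exact: leq_total.
apply: sub_pairwise => -[a b] [c d]; rewrite /r /ble xpair_eqE /=; lia.
Qed.

Lemma linear_cat s1 s2 :
  linear (s1 ++ s2) = [&& allrel (fun x y => ~~ ble y x) s1 s2, linear s1 & linear s2].
Proof. exact: pairwise_cat. Qed.

Lemma size_steps d w : size (steps d w) = (size w).-1.
Proof. by case: w => //= x w; rewrite size_pairmap. Qed.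

Lemma size_pat w : size (pat w) = (size w).-1.
Proof. exact: size_steps. Qed.

Lemma steps_cat d s x s' :
  steps d (s ++ x :: s') = steps d (rcons s x) ++ steps d (x :: s').
Proof.
by case: s => //= y s; rewrite -cat1s catA cats1 pairmap_cat last_rcons.
Qed.

Lemma steps_rcons d s x : s != [::] ->
  steps d (rcons s x) = rcons (steps d s) (d (last x s) x).
Proof. by case: s => // y s _ /=; rewrite -cats1 pairmap_cat -cats1. Qed.

(** Exchanging [v] for [v'] can show only inside the window and at its two borders. The default [h]
    is arbitrary since [v] may be empty. *)
Lemma steps_window d I J v v' : size v = size v' ->
  (forall x h, x \in I -> d x (head h v) = d x (head h v')) ->
  (forall x h, x \in J -> d (last h v) x = d (last h v') x) ->
  steps d v = steps d v' -> steps d (I ++ v ++ J) = steps d (I ++ v' ++ J).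
Proof.
case: v v' => [|x v] [|x' v'] //= [eq_sz] hI hJ eq_st.
have tl : steps d (x :: v ++ J) = steps d (x' :: v' ++ J).
  rewrite /= !pairmap_cat eq_st; congr (_ ++ _).
  by case: J hJ => //= y J /(_ y y (mem_head _ _)) ->.
rewrite !steps_cat tl; congr (_ ++ _).
case/lastP: I hI => // I z /(_ z x); rewrite mem_rcons mem_head /= => /(_ isT) eq_d.
by rewrite !(steps_rcons _ (s := rcons I z)) ?last_rcons ?eq_d //; case: (I).
Qed.

(** Boxes outside [V] that lie weakly northwest of some box of [V] are read before it, all others
    after it. This is consistent because, by convexity of [V], no box read before [V] lies southeast
    of a box of [V]. *)
Lemma frame (S V : seq cell) : uniq S -> uniq V -> {subset V <= S} ->
  (forall x y z, x \in V -> y \in V -> z \in S -> ble x z -> ble z y -> z \in V) ->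
  exists I, exists J, [/\
    forall x, x \in I -> [/\ x \in S, x \notin V & has (ble x) V],
    forall x, x \in J -> [/\ x \in S, x \notin V & ~~ has (ble x) V] &
    forall v, perm_eq v V -> linear v -> linext S (I ++ v ++ J)].
Proof.
move=> uS uV sVS cV.
have [I pI lI] := linear_arrangement (filter_uniq (fun x => (x \notin V) && has (ble x) V) uS).
have [J pJ lJ] := linear_arrangement (filter_uniq (fun x => (x \notin V) && ~~ has (ble x) V) uS).
have mI x : x \in I -> [/\ x \in S, x \notin V & has (ble x) V].
  by rewrite (perm_mem pI) mem_filter => /andP[/andP[]].
have mJ x : x \in J -> [/\ x \in S, x \notin V & ~~ has (ble x) V].
  by rewrite (perm_mem pJ) mem_filter => /andP[/andP[]].
exists I, J; split=> // v pv lv; apply/andP; split.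
  have uIJ : uniq (I ++ v ++ J).
    rewrite !cat_uniq (linear_uniq lI) (linear_uniq lJ) (linear_uniq lv) /= andbT.
    rewrite has_cat negb_or -andbA; apply/and3P; split; apply/hasPn => x.
    - by rewrite (perm_mem pv); apply: contraL => /mI[].
    - by case/mJ=> _ _; apply: contra => /mI[].
    - by case/mJ=> _ + _; rewrite -(perm_mem pv).
  apply: uniq_perm => // x; rewrite !mem_cat (perm_mem pI) (perm_mem pJ) (perm_mem pv).
  rewrite !mem_filter; case: (boolP (x \in V)) => [/sVS ->|_] /=; first by [].

  by case: has; rewrite ?orbF.
rewrite !linear_cat lI lv lJ /= !andbT; apply/andP; split.
  apply/allrelP => x y /mI[xS xV /hasP[z zV xz]]; rewrite mem_cat; apply/implyP.
  rewrite -implybNN negbK; apply/implyP => yx; rewrite negb_or.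
  apply/andP; split.
    by rewrite (perm_mem pv); apply: contra xV => yV; exact: cV yV zV xS yx xz.
  apply/negP => /mJ[_ _ /hasPn/(_ z zV)/negP]; apply; exact: ble_trans yx xz.
apply/allrelP => x y; rewrite (perm_mem pv) => xV /mJ[_ _ /hasPn]; exact.
Qed.

(* A window is a convex part V of S whose arrangements can be exchanged inside a
   fixed word of S; the descents at its two borders have to agree as well. *)
Lemma mfree_window (S V v v' : seq cell) :
  uniq S -> mfree S -> uniq V -> {subset V <= S} ->
  (forall x y z, x \in V -> y \in V -> z \in S -> ble x z -> ble z y -> z \in V) ->
  perm_eq v V -> perm_eq v' V -> linear v -> linear v' -> pat v = pat v' ->
  (forall x h, x \in S -> x \notin V -> has (ble x) V ->
     below x (head h v) = below x (head h v')) ->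
  (forall x h, x \in S -> x \notin V -> ~~ has (ble x) V ->
     below (last h v) x = below (last h v') x) ->
  v = v'.
Proof.
move=> uS mS uV sV cV pv pv' lv lv' eqp hI hJ.
have [I [J [mI mJ hl]]] := frame uS uV sV cV.
have eq_sz : size v = size v' by rewrite (perm_size pv) (perm_size pv').
have := mS _ _ (hl _ pv lv) (hl _ pv' lv').
rewrite /pat (steps_window (d := below) (v := v) (v' := v')) //; first last.
- by move=> x h /mJ[xS xV xb]; exact: hJ.
- by move=> x h /mI[xS xV xb]; exact: hI.
move=> /(_ erefl)/eqP; rewrite eqseq_cat // eqxx eqseq_cat //=.
by case/andP=> /eqP.
Qed.

(** * Rectangles *)

(** In a convex set two opposite corners bring the whole rectangle along; [b] is the lower right
    one. The inequalities guard against truncated subtraction. *)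
Definition rc (k l : nat) (S : seq cell) : nat :=
  count (fun b : cell => [&& k <= b.1, l <= b.2 & (b.1 - k, b.2 - l) \in S]) S.

(** Here [v] is the position of a letter in a word of length [n], and the first [v] bits of its
    pattern are the steps leading to that letter. *)
Definition prefixes_above (n : nat) (s p : seq bool) : nat :=
  count (fun v => subseq s (take v p)) (iota 0 n).

Definition desc_asc (k l : nat) : seq bool := nseq k true ++ nseq l false.

Lemma leq_count_in (T : eqType) (a1 a2 : pred T) s :
  {in s, forall x, a1 x -> a2 x} -> count a1 s <= count a2 s.
Proof.
elim: s => //= x s IHs h; apply: leq_add; last first.
  by apply: IHs => y ys; apply: h; rewrite inE ys orbT.
by have := h x (mem_head _ _); case: (a1 x) => // ->.
Qed.

Lemma steps_nth d w x0 i : i.+1 < size w ->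
  nth false (steps d w) i = d (nth x0 w i) (nth x0 w i.+1).
Proof. by case: w => //= x w lt_i; rewrite (nth_pairmap x0). Qed.

(** The intermediate value property of rows: a word that gets from one side of the row of letter [i]
    to the other must cross over in a single step. *)
Lemma pat_segment (w : seq cell) x0 i j : i < j < size w ->
  exists2 t, i <= t < j & nth false (pat w) t = below (nth x0 w i) (nth x0 w j).
Proof.
case/andP=> lt_ij; elim: j lt_ij => // j IHj; rewrite ltnS leq_eqVlt.
case/predU1P=> [<- lt_w|lt_ij lt_w].
  by exists i; rewrite ?leqnn //= /pat (steps_nth _ x0).
have [t /andP[le_it lt_tj] nth_t] := IHj lt_ij (ltnW lt_w).
have nth_j := steps_nth below x0 lt_w.
have [e|ne] := eqVneq (below (nth x0 w i) (nth x0 w j)) (below (nth x0 w i) (nth x0 w j.+1)).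
  by exists t; rewrite ?nth_t // le_it ltnS ltnW.
(* The comparison with letter [i] has just changed, so this last step is the crossing and has the
   required direction. *)
exists j; first by rewrite leqnn ltnW.
rewrite nth_j; move: ne; rewrite /below; lia.
Qed.

Lemma subseq_rcons_take (s p : seq bool) i j t :
  i <= t < j -> j <= size p -> subseq s (take i p) ->
  subseq (rcons s (nth false p t)) (take j p).
Proof.
case/andP=> le_it lt_tj le_jp sub_s.
rewrite -(cat_take_drop i (take j p)) -cats1; apply: cat_subseq.
  by rewrite take_takel // ltnW // (leq_ltn_trans le_it).
rewrite sub1seq; have -> : nth false p t = nth false (drop i (take j p)) (t - i).
  by rewrite nth_drop subnKC // nth_take.
by apply: mem_nth; rewrite size_drop size_takel //; lia.
Qed.

Lemma linear_index (w : seq cell) x y :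
  linear w -> x \in w -> y \in w -> ble x y -> x != y -> index x w < index y w.
Proof.
move=> lw xw yw xy ne; rewrite ltnNge leq_eqVlt negb_or; apply/andP; split.
  apply: contra ne => /eqP e; apply/eqP.
  by rewrite -(nth_index x xw) -(nth_index x yw) e.
apply/negP => lt_yx; move/(pairwiseP x): lw => /(_ (index y w) (index x w)).
by rewrite !inE !index_mem xw yw lt_yx !nth_index // xy => /(_ isT isT isT).
Qed.

Lemma nseq_rcons (T : Type) n (x : T) : nseq n.+1 x = rcons (nseq n x) x.
Proof. by rewrite -addn1 nseqD cats1. Qed.

(** Every word meets the boxes of the left side, going down, and then those of the bottom, going
    right, in this order. By [pat_segment] each move along this path contributes its own letter, and
    the segments of the word between these boxes are disjoint. *)
Lemma rect_subseq (S w : seq cell) k l (b : cell) : convex S -> linext S w ->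
  b \in S -> k <= b.1 -> l <= b.2 -> (b.1 - k, b.2 - l) \in S ->
  subseq (desc_asc k l) (take (index b w) (pat w)).
Proof.
move=> cS /andP[pw lw] bS le_k le_l aS.
have inw z : ble (b.1 - k, b.2 - l) z -> ble z b -> z \in w.
  by rewrite (perm_mem pw); exact: cS.
have step s (x y : cell) : x \in w -> y \in w -> ble x y -> x != y ->
    subseq s (take (index x w) (pat w)) ->
    subseq (rcons s (below x y)) (take (index y w) (pat w)).
  move=> xw yw xy ne sub.
  have lt_xy := linear_index lw xw yw xy ne.
  have lt_y : index y w < size w by rewrite index_mem.
  have /(pat_segment x) [t le_t] : index x w < index y w < size w by rewrite lt_xy.
  rewrite !nth_index // => <-; apply: subseq_rcons_take le_t _ sub.
  by rewrite size_pat -ltnS prednK // (leq_ltn_trans _ lt_y).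
have col t : t <= k ->
    subseq (nseq t true) (take (index (b.1 - k + t, b.2 - l) w) (pat w)).
  elim: t => [|t IHt] le_t; first by rewrite sub0seq.
  have -> : nseq t.+1 true =
      rcons (nseq t true) (below (b.1 - k + t, b.2 - l) (b.1 - k + t.+1, b.2 - l)).
    by rewrite nseq_rcons /below /= addnS ltnS leqnn.
  apply: step (IHt (ltnW le_t)); rewrite ?inw //; rewrite /ble ?xpair_eqE /=; lia.
have row t : t <= l ->
    subseq (desc_asc k t) (take (index (b.1, b.2 - l + t) w) (pat w)).
  elim: t => [|t IHt] le_t; first by have := col k (leqnn k); rewrite subnK // /desc_asc cats0 addn0.
  have -> : desc_asc k t.+1 =
      rcons (desc_asc k t) (below (b.1, b.2 - l + t) (b.1, b.2 - l + t.+1)).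
    by rewrite /desc_asc nseq_rcons rcons_cat /below /= ltnn.
  apply: step (IHt (ltnW le_t)); rewrite ?inw //; rewrite /ble ?xpair_eqE /=; lia.
by have := row l (leqnn l); rewrite subnK // -surjective_pairing.
Qed.

Lemma rc_le_prefixes (S w : seq cell) k l : convex S -> linext S w ->
  rc k l S <= prefixes_above (size S) (desc_asc k l) (pat w).
Proof.
move=> cS lw; have /andP[pw linw] := lw; have uw := linear_uniq linw.
rewrite /rc /prefixes_above -(permP pw) -(perm_size pw).
pose x0 : cell := (0, 0).
rewrite -{1}(mkseq_nth x0 w) /mkseq count_map; apply: leq_count_in => v.
rewrite mem_iota add0n /= => lt_v.
case/and3P=> le_k le_l aS; have bS : nth x0 w v \in S by rewrite -(perm_mem pw) mem_nth.
by have := rect_subseq cS lw bS le_k le_l aS; rewrite index_uniq.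
Qed.

(** * Transposition *)

Definition swap (x : cell) : cell := (x.2, x.1).

Lemma swapK : involutive swap. Proof. by case. Qed.

Lemma swap_inj : injective swap. Proof. exact: inv_inj swapK. Qed.

Lemma mem_swap x (S : seq cell) : (x \in map swap S) = (swap x \in S).
Proof. by rewrite -{1}(swapK x) mem_map //; exact: swap_inj. Qed.

Lemma map_swapK : involutive (map swap). Proof. exact: mapK swapK. Qed.

Lemma ble_swap x y : ble (swap x) (swap y) = ble x y.
Proof. exact: andbC. Qed.

Lemma convex_swap S : convex S -> convex (map swap S).
Proof.
move=> cS x y z; rewrite !mem_swap => xS yS xz zy.
by apply: cS xS yS _ _; rewrite ble_swap.
Qed.

Lemma linext_swap S w : linext S w -> linext (map swap S) (map swap w).
Proof.
case/andP=> pw lw; rewrite /linext perm_map //= /linear pairwise_map.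
by apply: sub_pairwise lw => x y; rewrite /= ble_swap.
Qed.

Lemma rc_swap k l S : rc k l (map swap S) = rc l k S.
Proof. by rewrite /rc count_map; apply: eq_count => x /=; rewrite mem_swap andbCA. Qed.

(** Of two consecutive letters the second is never both strictly below and strictly right of the
    first: the box in the row of the first and the column of the second would have to be read
    between them. So the second is either lower or further right, and not both. *)
Lemma pat_swap S w : convex S -> linext S w -> pat (map swap w) = map negb (pat w).
Proof.
move=> cS lw; apply: (@eq_from_nth _ false); rewrite ?(size_map, size_pat) // => i lt_i.
have lt_iw : i.+1 < size w by case: (w) lt_i.
have x0 : cell by exact: (0, 0).
rewrite (nth_map false) ?size_pat // /pat !(steps_nth _ x0) ?size_map //.
rewrite !(nth_map x0) ?(ltnW lt_iw) //.
have /andP[pw linw] := lw.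
set x := nth x0 w i; set y := nth x0 w i.+1.
have xw : x \in w by rewrite mem_nth // ltnW.
have yw : y \in w by rewrite mem_nth.
have uw := linear_uniq linw.
have ix : index x w = i by rewrite index_uniq // ltnW.
have iy : index y w = i.+1 by rewrite index_uniq.
have nxy : ~~ ble y x by move/(pairwiseP x0): linw; apply; rewrite ?inE // ltnW.
have hz z : ble x z -> ble z y -> (z == x) || (z == y).
  move=> xz zy; apply/norP => -[nx ny].
  have zw : z \in w by rewrite (perm_mem pw); apply: cS xz zy; rewrite -(perm_mem pw).
  have := linear_index linw xw zw xz; rewrite eq_sym => /(_ nx).
  by have := linear_index linw zw yw zy ny; rewrite ix iy ltnS leqNgt => /negP.
case: (x) (y) nxy hz => [a b] [c d]; rewrite /below /swap /ble /= => nxy hz.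
have := hz (a, d); rewrite /= !xpair_eqE eqxx /= (eqxx d) andbT => {}hz.
lia.
Qed.

Lemma mfree_swap S : convex S -> mfree S -> mfree (map swap S).
Proof.
move=> cS mS w w' lw lw' eqp.
have cS' := convex_swap cS.
have l := linext_swap lw; have l' := linext_swap lw'; rewrite map_swapK in l l'.
apply: (can_inj map_swapK); apply: mS => //.
by rewrite (pat_swap cS' lw) (pat_swap cS' lw') eqp.
Qed.

Lemma occurs_swap S p : convex S -> occurs S p -> occurs (map swap S) (map negb p).
Proof.
by move=> cS [w lw <-]; exists (map swap w); [exact: linext_swap|exact: pat_swap lw].
Qed.

Lemma path_pairmap_nseq (T : Type) (d : T -> T -> bool) (e : bool) x s :
  path (fun y z => d y z == e) x s -> pairmap d x s = nseq (size s) e.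
Proof. by elim: s x => //= y s IHs x /andP[/eqP-> /IHs ->]. Qed.

Lemma sorted_steps_nseq d e w :
  sorted (fun y z => d y z == e) w -> steps d w = nseq (size w).-1 e.
Proof. by case: w => //= x w; exact: path_pairmap_nseq. Qed.

(** * Sharpness of the rectangle bound *)

Definition above (x : cell) : cell := (x.1.-1, x.2).
Definition has_above (S : seq cell) (x : cell) : bool := (0 < x.1) && (above x \in S).

Lemma subseq_strip (e : bool) s m t :
  subseq (e :: s) (nseq m (~~ e) ++ t) = subseq (e :: s) t.
Proof. by case: e; elim: m. Qed.

Lemma convex_has_above S : convex S -> convex (filter (has_above S) S).
Proof.
move=> cS x y z; rewrite !mem_filter => /andP[/andP[x0 ax] xS] /andP[_ yS] xz zy.
have zS := cS _ _ _ xS yS xz zy; rewrite zS andbT; apply/andP; split.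
  by move: xz; rewrite /ble; lia.
by apply: cS ax zS _ _; move: xz; rewrite /ble /=; lia.
Qed.

(** The upper left corner survives the removal of column tops exactly when the rectangle extends one
    row further up; by convexity the lower right corner then survives too. *)
Lemma rc_has_above k l S : convex S -> rc k l (filter (has_above S) S) = rc k.+1 l S.
Proof.
move=> cS; rewrite /rc count_filter; apply: eq_in_count => -[i j] ijS /=.
rewrite mem_filter /has_above /above /=.
apply/idP/idP => [/andP[/and3P[h1 h2 /andP[/andP[h3 h4] h5]] _]|/and3P[h1 h2 h3]].
  by rewrite h2 subnS h4 andbT; lia.
have /= hS z := cS _ _ z h3 ijS.
rewrite h2 -subnS h3 !hS ?andbT; rewrite /ble /=; lia.
Qed.

(* Reading first the highest box of every column, from left to right, gives a
   descent-free block. *)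
Lemma trim_top S w' : convex S -> uniq S -> linext (filter (has_above S) S) w' ->
  exists2 w, linext S w & forall s,
    prefixes_above (size S) (true :: s) (pat w) <= prefixes_above (size w') s (pat w').
Proof.
move=> cS uS /andP[pw' lw'].
pose tp := filter (predC (has_above S)) S.
pose r := relpre (fun x : cell => x.2) leq.
have r_tr : transitive r by move=> y x z; exact: leq_trans.
pose ts := sort r tp.
have mts x : x \in ts = ~~ has_above S x && (x \in S) by rewrite mem_sort mem_filter.
have pts : pairwise (fun x y => ~~ ble y x && (below x y == false)) ts.
  have : pairwise (fun x y => (x != y) && r x y) ts.
    rewrite pairwise_relI -uniq_pairwise sort_uniq filter_uniq // -sorted_pairwise //.
    by apply: sort_sorted => x y; exact: leq_total.
  apply: (sub_in_pairwise (P := mem ts)); last exact/allP.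
  move=> [a b] [c d]; rewrite !inE !mts => /andP[nx xS] /andP[ny yS] /andP[]; rewrite /r /= xpair_eqE => ne bd.
  (* A column top is never lower than a box weakly to its left: convexity would put the box above it
     into [S]. Hence the tops, read from left to right, never go down. *)
  have hS a' b' c' d' : (a', b') \in S -> (c', d') \in S -> ~~ has_above S (c', d') ->
      b' <= d' -> c' <= a'.
    move=> xS' yS' ny' bd'; rewrite leqNgt; apply/negP => ac.
    case/negP: ny'; rewrite /has_above /above /=.
    apply/andP; split; first by lia.
    by apply: cS xS' yS' _ _; rewrite /ble /=; lia.
  have ca := hS _ _ _ _ xS yS ny bd; have := hS _ _ _ _ yS xS nx.
  by rewrite /ble /below /=; move: ne ca bd; lia.
have [lts sts] : linear ts /\ steps below ts = nseq (size ts).-1 false.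
  move: pts; rewrite pairwise_relI => /andP[h1 /pairwise_sorted h2]; split=> //.
  exact: sorted_steps_nseq.
have lt : linext S (ts ++ w').
  apply/andP; split.
    rewrite perm_catC; apply: perm_trans (perm_cat pw' (permEl (perm_sort r tp))) _.
    exact: permEl (perm_filterC _ _).
  rewrite linear_cat lts lw' !andbT; apply/allrelP => x y; rewrite mts (perm_mem pw').
  rewrite mem_filter => /andP[nx xS] /andP[/andP[y0 ay] yS]; apply: contra nx => yx.
  rewrite /has_above; apply/andP; split; first by move: yx; rewrite /ble; lia.
  by apply: cS ay xS _ _; move: yx; rewrite /ble /=; lia.
have szS : size S = size ts + size w'.
  by have /andP[/perm_size <- _] := lt; rewrite size_cat.
exists (ts ++ w') => // s; rewrite szS /prefixes_above iotaD count_cat.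
(* Up to the last column top only ascents have been made, so no prefix contains the leading
   [true]. *)
rewrite (_ : count _ (iota 0 (size ts)) = 0); last first.
  apply/eqP; rewrite -leqn0 leqNgt -has_count; apply/hasPn => v.
  rewrite mem_iota add0n /= => lt_v; apply/negP => /mem_subseq/(_ _ (mem_head _ _)).
  have -> : take v (pat (ts ++ w')) = take v (steps below ts).
    case: (w') => [|y t]; first by rewrite cats0.
    rewrite /pat steps_cat takel_cat ?size_steps ?size_rcons 1?ltnW //.
    rewrite steps_rcons; last by case: (ts) lt_v.
    by rewrite -cats1 takel_cat // size_steps; case: (ts) lt_v.
  by rewrite sts => /mem_take/nseqP[].
rewrite !add0n -[X in iota X _]addn0 iotaDl count_map; apply: leq_count_in => v.
rewrite mem_iota add0n /= => lt_v; rewrite /preim /=.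
case: w' lt_v {pw' lw' lt szS} => // y t lt_v; rewrite /pat steps_cat.
rewrite take_cat ifN; last by rewrite size_steps size_rcons /=; lia.
rewrite size_steps size_rcons /= addKn.
(* The step from the tops into [w'] may be a descent, but it can only absorb the leading [true];
   then [s] must fit into the pattern of [w']. *)
case/lastP: ts sts {mts pts lts} => [|ts z] sts.
  by move/(subseq_trans (subseq_cons _ _)).
rewrite steps_rcons ?last_rcons ?sts; last by case: (ts).
rewrite -cats1 -catA subseq_strip /=.
by case: ifP => // _ /(subseq_trans (subseq_cons _ _)).
Qed.

Lemma prefixes_above_negb n s p :
  prefixes_above n (map negb s) (map negb p) = prefixes_above n s p.
Proof.
apply: eq_count => v; rewrite -map_take; apply/idP/idP; last exact: map_subseq.
by move/(map_subseq negb); rewrite !(mapK negbK).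
Qed.

(** [trim_top] strips one D and lowers [k]. Once [k] is 0, the same lemma on the transposed shape,
    where the pattern is negated, strips one N and lowers [l]. *)
Lemma prefixes_attained k l S : convex S -> uniq S ->
  exists2 w, linext S w & prefixes_above (size S) (desc_asc k l) (pat w) <= rc k l S.
Proof.
elim: k S => [|k IHk] S cS uS.
  elim: l S cS uS => [|l IHl] S cS uS.
    have [w pw lw] := linear_arrangement uS; exists w; first by rewrite /linext pw.
    rewrite /rc /prefixes_above (_ : count _ S = size S).
      by apply: leq_trans (count_size _ _) _; rewrite size_iota.
    by apply/eqP; rewrite -all_count; apply/allP => x xS /=; rewrite !subn0 -surjective_pairing.
  have cS' := convex_swap cS; have uS' : uniq (map swap S) by rewrite map_inj_uniq //; exact: swap_inj.
  have cT := convex_has_above cS'.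
  set T := filter _ _ in cT.
  have uT : uniq T by rewrite filter_uniq.
  have [w lw hw] := IHl _ (convex_swap cT) (etrans (map_inj_uniq swap_inj _) uT).
  have lw' := linext_swap lw; rewrite map_swapK in lw'.
  have [v lv hv] := trim_top cS' uS' lw'.
  have := linext_swap lv; rewrite map_swapK => lv'; exists (map swap v) => //.
  rewrite (pat_swap cS' lv) -(prefixes_above_negb _ (desc_asc _ _)) (mapK negbK).
  rewrite /desc_asc /= map_nseq /=; have := hv (nseq l true); rewrite size_map => /leq_trans.
  apply; rewrite (pat_swap (convex_swap cT) lw) size_map.
  have -> : nseq l true = map negb (nseq l false) by rewrite map_nseq.
  rewrite prefixes_above_negb.
  have /andP[pw _] := lw; rewrite (perm_size pw); apply: leq_trans hw _.
  by rewrite rc_swap (rc_has_above _ _ cS') rc_swap.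
have cT := convex_has_above cS; have uT := filter_uniq (has_above S) uS.
have [w lw hw] := IHk _ cT uT.
have [v lv hv] := trim_top cS uS lw; exists v => //.
apply: leq_trans (hv _) _; rewrite -rc_has_above //.
by have /andP[pw _] := lw; rewrite (perm_size pw).
Qed.

(** * Shapes without 2 x 2 square *)

(** No box is strictly southeast of another; for convex sets this means that there is no 2 x 2
    square, by [thin_or_square]. *)
Definition thin (S : seq cell) : Prop :=
  forall x y, x \in S -> y \in S -> x.1 < y.1 -> y.2 <= x.2.

Definition ne_step (x y : cell) : bool := [&& y.1 <= x.1, x.2 <= y.2 & x != y].

(* y has smaller content (column minus row) than x *)
Definition content_gt (x y : cell) : bool := y.2 + x.1 < x.2 + y.1.

Lemma thin_sorted S : uniq S -> thin S ->
  exists2 xs, perm_eq xs S & pairwise ne_step xs.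
Proof.
move=> uS tS; pose r := fun x y : cell => ~~ content_gt x y.
have r_tr : transitive r by move=> y x z; rewrite /r /content_gt; lia.
have r_tot : total r by move=> x y; rewrite /r /content_gt; lia.
exists (sort r S); first by rewrite perm_sort.
have : pairwise (fun x y => (x != y) && r x y) (sort r S).
  rewrite pairwise_relI -uniq_pairwise sort_uniq uS -sorted_pairwise //.
  exact: sort_sorted.
apply: (sub_in_pairwise (P := mem S)); last by apply/allP => x; rewrite mem_sort.
move=> x y xS yS /andP[nxy]; rewrite /r /content_gt /ne_step nxy andbT => hr.
have := tS _ _ xS yS; have := tS _ _ yS xS; clear -hr; move: hr => /=. lia.
Qed.

(** A lower next letter is weakly to the left by thinness, and any other next letter is strictly to
    the right by linearity. Contents are preferable to rows since they strictly increase along the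
    order of [thin_sorted]. *)
Lemma thin_pat S w : thin S -> {subset w <= S} -> linear w ->
  pat w = steps content_gt w.
Proof.
move=> tS; case: w => //= x w; elim: w x => //= y w IHw x sub /andP[/andP[nyx nxw] lyw].
rewrite (IHw y) // => [|z zw]; last by apply: sub; rewrite inE zw orbT.
congr (_ :: _); have xS : x \in S by apply: sub; rewrite mem_head.
have yS : y \in S by apply: sub; rewrite !inE eqxx orbT.
have := tS _ _ xS yS; move: nyx.
case: (x) (y) => [a b] [c d]; rewrite /below /content_gt /ble /=; clear; lia.
Qed.

Lemma thin_window S l V r v v' : uniq S -> thin S -> mfree S ->
  perm_eq (l ++ V ++ r) S -> pairwise ne_step (l ++ V ++ r) ->
  perm_eq v V -> perm_eq v' V -> linear v -> linear v' ->
  steps content_gt v = steps content_gt v' -> v = v'.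
Proof.
move=> uS tS mS; case: V => [_ _ /perm_nilP-> /perm_nilP->//|g V0]; set V := g :: V0 => pS.
rewrite !pairwise_cat allrel_catr.
case/and4P=> /andP[/allrelP lV _] _ /allrelP Vr /andP[_ _].
move=> pv pv' lv lv' eqs.
have mS' x : x \in S = [|| x \in l, x \in V | x \in r] by rewrite -(perm_mem pS) !mem_cat.
have uV : uniq V by move: uS; rewrite -(perm_uniq pS) !cat_uniq => /and4P[].
have [||I [J [mI mJ hl]]] := frame uS uV.
- by move=> x xV; rewrite mS' xV orbT.
- move=> x y z xV yV zS xz zy; move: (zS); rewrite mS' => /or3P[zl|//|zr].
    have := lV _ _ zl xV; have := lV _ _ zl yV; move: xz zy.
    have xS : x \in S by rewrite mS' xV orbT.
    have yS : y \in S by rewrite mS' yV orbT.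
    have := tS _ _ xS yS; case: x y z {xV yV zl zS xS yS} => [a b] [c d] [e f].
    rewrite /ble /ne_step !xpair_eqE /=; clear; lia.
  have := Vr _ _ xV zr; have := Vr _ _ yV zr; move: xz zy.
  have xS : x \in S by rewrite mS' xV orbT.
  have yS : y \in S by rewrite mS' yV orbT.
  have := tS _ _ xS yS; case: x y z {xV yV zr zS xS yS} => [a b] [c d] [e f].
  rewrite /ble /ne_step !xpair_eqE /=; clear; lia.
have out x y y' : x \in S -> x \notin V -> y \in V -> y' \in V ->
    content_gt x y = content_gt x y' /\ content_gt y x = content_gt y' x.
  rewrite mS' => /or3P[xl _ yV y'V|-> //|xr _ yV y'V].
    have := lV _ _ xl yV; have := lV _ _ xl y'V.
    case: x y y' {xl yV y'V} => [a b] [c d] [e f].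
    rewrite /content_gt /ne_step !xpair_eqE /=; clear; lia.
  have := Vr _ _ yV xr; have := Vr _ _ y'V xr.
  case: x y y' {xr yV y'V} => [a b] [c d] [e f].
  rewrite /content_gt /ne_step !xpair_eqE /=; clear; lia.
have sz : size v = size v' by rewrite (perm_size pv) (perm_size pv').
have hw u : perm_eq u V -> linear u -> pat (I ++ u ++ J) = steps content_gt (I ++ u ++ J).
  move=> pu lu; have /andP[p1 l1] := hl _ pu lu; apply: thin_pat tS _ l1.
  by move=> x; rewrite (perm_mem p1).
have ends (u : seq cell) h : perm_eq u (g :: V0) ->
    head h u \in g :: V0 /\ last h u \in g :: V0.
  case: u => [/perm_size//|z u pu]; split; rewrite -(perm_mem pu) /=.
    exact: mem_head.
  exact: mem_last.
have := mS _ _ (hl _ pv lv) (hl _ pv' lv'); rewrite !hw //.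
rewrite (steps_window (v := v) (v' := v')) //.
- by move=> /(_ erefl)/eqP; rewrite eqseq_cat // eqxx eqseq_cat //= => /andP[/eqP].
- by move=> x h /mI[xS xV _]; case: (out x _ _ xS xV (ends v h pv).1 (ends v' h pv').1).
- by move=> x h /mJ[xS xV _]; case: (out x _ _ xS xV (ends v h pv).2 (ends v' h pv').2).
Qed.

Lemma pairmap_rcons (T1 T2 : Type) (f : T1 -> T1 -> T2) x s y :
  pairmap f x (rcons s y) = rcons (pairmap f x s) (f (last x s) y).
Proof. by rewrite -cats1 pairmap_cat /= cats1. Qed.

Lemma ne_step_content x y : ne_step x y -> content_gt y x.
Proof.
case: x y => [a b] [c d]; rewrite /ne_step /content_gt xpair_eqE /=; lia.
Qed.

Lemma ne_step_contentF x y : ne_step x y -> content_gt x y = false.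
Proof. by move/ne_step_content; rewrite /content_gt; clear; lia. Qed.

Lemma pairwise_rev (T : Type) (r : rel T) s :
  pairwise r (rev s) = pairwise (fun x y => r y x) s.
Proof. by elim: s => //= x s IHs; rewrite rev_cons pairwise_rcons IHs all_rev. Qed.

Lemma ne_pairmap x s : pairwise ne_step (x :: s) ->
  pairmap content_gt x s = nseq (size s) false.
Proof.
move=> ps; apply: path_pairmap_nseq; apply: pairwise_sorted (x :: s) _.
apply: sub_pairwise ps => y z /ne_step_content; rewrite /content_gt; lia.
Qed.

Lemma ne_pairmap_rev x s y : pairwise ne_step (y :: rcons s x) ->
  pairmap content_gt x (rcons (rev s) y) = nseq (size s).+1 true.
Proof.
move=> ps; rewrite (path_pairmap_nseq (e := true)) ?size_rcons ?size_rev //.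
have : pairwise content_gt (rev (y :: rcons s x)).
  by rewrite pairwise_rev; apply: sub_pairwise ps => a b /ne_step_content.
rewrite rev_cons rev_rcons => /pairwise_sorted; apply: sub_path => a b /= ->.
by [].
Qed.

(** With D for a drop of content, [v1] and [v2] both have the pattern N D^(size m + 1) N: the
    downward run leads from [u] to [v] in the first word and from [y] to [z] in the second. *)
Lemma bad_column (S l m r : seq cell) (z v u y : cell) : uniq S -> thin S -> mfree S ->
  perm_eq (l ++ (z :: v :: rcons (rcons m u) y) ++ r) S ->
  pairwise ne_step (l ++ (z :: v :: rcons (rcons m u) y) ++ r) ->
  pairwise (fun a b : cell => b.1 < a.1) (v :: rcons m u) ->
  z.2 < v.2 -> u.2 < y.2 -> False.
Proof.
move=> uS tS mS pS pxs rows zv uy.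
pose v1 := z :: u :: rcons (rcons (rev m) v) y.
pose v2 := u :: y :: rcons (rcons (rev m) z) v.
have pW : pairwise ne_step (z :: v :: rcons (rcons m u) y).
  by move: pxs; rewrite !pairwise_cat => /and3P[_ _ /and3P[]].
have sub s : subseq s (z :: v :: rcons (rcons m u) y) -> pairwise ne_step s.
  by move/subseq_pairwise/(_ pW).
move: (pW) rows; rewrite /= !(all_rcons, pairwise_rcons).
case/and3P=> /and4P[n1 n2 n3 n4] /and3P[n5 n6 n7] /andP[/andP[n8 n9] /andP[n10 n11]].
case/and3P=> /andP[r1 r2] r3 r4.
have [vz _ _] := and3P n1; have [yu _ _] := and3P n8; have [_ vu _] := and3P n6.
have hm a : a \in m -> [/\ u.1 < a.1, a.1 < v.1, a.2 <= u.2 & v.2 <= a.2].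
  move=> am; split; [exact: (allP r3 a am)|exact: (allP r2 a am)| |].
    by have [] := and3P (allP n10 a am).
  by have [] := and3P (allP n7 a am).
suff [e _] : v1 = v2 by move: n3; rewrite e /ne_step eqxx !andbF.
apply: (thin_window uS tS mS pS pxs).
- by apply/permP => a; rewrite /= -!cats1 !count_cat count_rev /= !addn0; move: (count a m) (a z : nat) (a v : nat) (a u : nat) (a y : nat); clear; lia.
- by apply/permP => a; rewrite /= -!cats1 !count_cat count_rev /= !addn0; move: (count a m) (a z : nat) (a v : nat) (a u : nat) (a y : nat); clear; lia.
- rewrite /linear /= !(all_rcons, pairwise_rcons) !all_rev pairwise_rev /ble.
  repeat (apply/andP; split).
  all: try (by apply/allP => -[a1 a2] /hm[]; move: zv uy vz yu vu r1; clear;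
   case: z v u y => [z1 z2] [v1 v2] [u1 u2] [y1 y2] /=; lia).
  all: try by move: zv uy vz yu vu r1; clear;
   case: z v u y => [z1 z2] [v1 v2] [u1 u2] [y1 y2] /=; lia.
  by apply: sub_pairwise r4 => -[a1 a2] [b1 b2] /=; clear; lia.
- rewrite /linear /= !(all_rcons, pairwise_rcons) !all_rev pairwise_rev /ble.
  repeat (apply/andP; split).
  all: try (by apply/allP => -[a1 a2] /hm[]; move: zv uy vz yu vu r1; clear;
   case: z v u y => [z1 z2] [v1 v2] [u1 u2] [y1 y2] /=; lia).
  all: try by move: zv uy vz yu vu r1; clear;
   case: z v u y => [z1 z2] [v1 v2] [u1 u2] [y1 y2] /=; lia.
  by apply: sub_pairwise r4 => -[a1 a2] [b1 b2] /=; clear; lia.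
rewrite /= (pairmap_rcons _ u) (pairmap_rcons _ y) !ne_pairmap_rev; first last.
- by rewrite /= !(all_rcons, pairwise_rcons) n6 n7 n10.
- by rewrite /= !(all_rcons, pairwise_rcons) n2 n4 n9.
by rewrite !last_rcons !ne_step_contentF.
Qed.

(** The transposed configuration; both words have the pattern D N^(size m + 1) D. *)
Lemma bad_row (S l m r : seq cell) (z v u y : cell) : uniq S -> thin S -> mfree S ->
  perm_eq (l ++ (z :: v :: rcons (rcons m u) y) ++ r) S ->
  pairwise ne_step (l ++ (z :: v :: rcons (rcons m u) y) ++ r) ->
  pairwise (fun a b : cell => a.2 < b.2) (v :: rcons m u) ->
  v.1 < z.1 -> y.1 < u.1 -> False.
Proof.
move=> uS tS mS pS pxs cols zv uy.
pose v1 := y :: v :: rcons (rcons m u) z.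
pose v2 := v :: z :: rcons (rcons m y) u.
have pW : pairwise ne_step (z :: v :: rcons (rcons m u) y).
  by move: pxs; rewrite !pairwise_cat => /and3P[_ _ /and3P[]].
move: (pW) cols; rewrite /= !(all_rcons, pairwise_rcons).
case/and3P=> /and4P[n1 n2 n3 n4] /and3P[n5 n6 n7] /andP[/andP[n8 n9] /andP[n10 n11]].
case/and3P=> /andP[r1 r2] r3 r4.
have [_ vz _] := and3P n1; have [_ yu _] := and3P n8; have [vu _ _] := and3P n6.
have hm a : a \in m -> [/\ a.2 < u.2, v.2 < a.2, u.1 <= a.1 & a.1 <= v.1].
  move=> am; split; [exact: (allP r3 a am)|exact: (allP r2 a am)| |].
    by have [] := and3P (allP n10 a am).
  by have [] := and3P (allP n7 a am).
suff [_ e] : v1 = v2 by move: n1; rewrite e /ne_step eqxx !andbF.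
apply: (thin_window uS tS mS pS pxs).
- by apply/permP => a; rewrite /= -!cats1 !count_cat /= !addn0; move: (count a m) (a z : nat) (a v : nat) (a u : nat) (a y : nat); clear; lia.
- by apply/permP => a; rewrite /= -!cats1 !count_cat /= !addn0; move: (count a m) (a z : nat) (a v : nat) (a u : nat) (a y : nat); clear; lia.
- rewrite /linear /= !(all_rcons, pairwise_rcons) /ble.
  repeat (apply/andP; split).
  all: try (by apply/allP => -[a1 a2] /hm[]; move: zv uy vz yu vu r1; clear;
   case: z v u y => [z1 z2] [v1 v2] [u1 u2] [y1 y2] /=; lia).
  all: try by move: zv uy vz yu vu r1; clear;
   case: z v u y => [z1 z2] [v1 v2] [u1 u2] [y1 y2] /=; lia.
  by apply: sub_pairwise r4 => -[a1 a2] [b1 b2] /=; clear; lia.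
- rewrite /linear /= !(all_rcons, pairwise_rcons) /ble.
  repeat (apply/andP; split).
  all: try (by apply/allP => -[a1 a2] /hm[]; move: zv uy vz yu vu r1; clear;
   case: z v u y => [z1 z2] [v1 v2] [u1 u2] [y1 y2] /=; lia).
  all: try by move: zv uy vz yu vu r1; clear;
   case: z v u y => [z1 z2] [v1 v2] [u1 u2] [y1 y2] /=; lia.
  by apply: sub_pairwise r4 => -[a1 a2] [b1 b2] /=; clear; lia.
rewrite /= (pairmap_rcons _ v) (pairmap_rcons _ z) !ne_pairmap; first last.
- by rewrite /= !(all_rcons, pairwise_rcons) n6 n7 n10.
- by rewrite /= !(all_rcons, pairwise_rcons) n2 n4 n9.
by rewrite !last_rcons !size_rcons !(ne_step_content n1, ne_step_content n5, ne_step_content n3, ne_step_content n8).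
Qed.

(** Three pairwise incomparable boxes have two arrangements with pattern N D. *)
Lemma bad_antichain (S l r : seq cell) (x1 x2 x3 : cell) : uniq S -> thin S -> mfree S ->
  perm_eq (l ++ [:: x1; x2; x3] ++ r) S ->
  pairwise ne_step (l ++ [:: x1; x2; x3] ++ r) ->
  x2.1 < x1.1 -> x1.2 < x2.2 -> x3.1 < x2.1 -> x2.2 < x3.2 -> False.
Proof.
move=> uS tS mS pS pxs h1 h2 h3 h4.
have pW : pairwise ne_step [:: x1; x2; x3].
  by move: pxs; rewrite !pairwise_cat => /and3P[_ _ /and3P[]].
move: pW; rewrite /= !andbT => /andP[/andP[n1 n2] n3].
suff [e _] : [:: x1; x3; x2] = [:: x2; x3; x1] by move: h1; rewrite e ltnn.
apply: (thin_window uS tS mS pS pxs).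
- by apply/permP => a; rewrite /= !addn0; move: (a x1 : nat) (a x2 : nat) (a x3 : nat); clear; lia.
- by apply/permP => a; rewrite /= !addn0; move: (a x1 : nat) (a x2 : nat) (a x3 : nat); clear; lia.
- move: h1 h2 h3 h4; clear; case: x1 x2 x3 => [? ?] [? ?] [? ?]; rewrite /linear /ble /=; lia.
- move: h1 h2 h3 h4; clear; case: x1 x2 x3 => [? ?] [? ?] [? ?]; rewrite /linear /ble /=; lia.
rewrite /= !(ne_step_content n1, ne_step_content n2, ne_step_content n3).
by rewrite !ne_step_contentF.
Qed.

Lemma split_prefix (T : Type) (P : pred T) (s : seq T) :
  exists s1 s2, [/\ s = s1 ++ s2, all P s1 & if s2 is y :: _ then ~~ P y else true].
Proof.
elim: s => [|x s [s1 [s2 [-> h1 h2]]]]; first by exists [::], [::].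
case Px: (P x); first by exists (x :: s1), s2; rewrite /= Px.
by exists [::], (x :: s1 ++ s2); rewrite /= Px.
Qed.

Lemma last_two (T : Type) (x y : T) s : exists s' z v, x :: y :: s = s' ++ [:: z; v].
Proof.
elim: s x y => [|t s IHs] x y; first by exists [::], x, y.
by have [s' [z [v ->]]] := IHs y t; exists (x :: s'), z, v.
Qed.

(** Otherwise let [y] be the first box that leaves the column of [u]. It lies further right, and
    [bad_column] applies to [z], the run from [v] to the box before [y], and [y]. *)
Lemma column_to_end (S l t : seq cell) (z v u : cell) :
  uniq S -> thin S -> mfree S -> perm_eq (l ++ z :: v :: u :: t) S ->
  pairwise ne_step (l ++ z :: v :: u :: t) ->
  u.1 < v.1 -> z.2 < v.2 -> all (fun y => y.2 == u.2) t.
Proof.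
move=> uS tS mS pS pxs uv zv.
have [C [[|y t'] [e hC hy]]] := split_prefix (fun y : cell => y.2 == u.2) t.
  by rewrite e cats0.
case: (@bad_column S l (belast u C) t' z v (last u C) y) => //; rewrite -?lastI.
- by rewrite -cats1 /= -catA /= -e.
- by rewrite -cats1 /= -catA /= -e.
- move: pxs; rewrite e pairwise_cat /= pairwise_cat !all_cat.
  case/and3P=> _ _ /and4P[_ /andP[nvu _] /andP[/allP nuC _] /and3P[_ nC _]].
  have hu a : a \in C -> (a.1 < u.1).
    move=> aC; have := allP hC a aC; have := nuC a aC; move: (u) (a); clear => -[u1 u2] [a1 a2].
    rewrite /ne_step xpair_eqE /=; lia.
  rewrite uv /=; apply/and3P; split.
  - by apply/allP => a /hu /= h; exact: ltn_trans h uv.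
  - by apply/allP => a /hu.
  apply: (sub_in_pairwise (P := mem C)) nC; last exact/allP.
  move=> a b aC bC; have := allP hC a aC; have := allP hC b bC; move: (u) (a) (b).
  by clear => -[u1 u2] [a1 a2] [b1 b2]; rewrite /ne_step xpair_eqE /=; lia.
- have : last u C \in u :: C by exact: mem_last.
  have : ne_step u y.
    move: pxs; rewrite e pairwise_cat /= => /and3P[_ _ /and4P[_ _ + _]].
    by rewrite all_cat /= => /and3P[].
  rewrite inE => /and3P[_ nuy _] /predU1P[->|/(allP hC)/eqP->]; move: hy nuy; clear; lia.
Qed.

Lemma row_to_end (S l t : seq cell) (z v u : cell) :
  uniq S -> thin S -> mfree S -> perm_eq (l ++ z :: v :: u :: t) S ->
  pairwise ne_step (l ++ z :: v :: u :: t) ->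
  v.2 < u.2 -> v.1 < z.1 -> all (fun y => y.1 == u.1) t.
Proof.
move=> uS tS mS pS pxs uv zv.
have [C [[|y t'] [e hC hy]]] := split_prefix (fun y : cell => y.1 == u.1) t.
  by rewrite e cats0.
case: (@bad_row S l (belast u C) t' z v (last u C) y) => //; rewrite -?lastI.
- by rewrite -cats1 /= -catA /= -e.
- by rewrite -cats1 /= -catA /= -e.
- move: pxs; rewrite e pairwise_cat /= pairwise_cat !all_cat.
  case/and3P=> _ _ /and4P[_ /andP[nvu _] /andP[/allP nuC _] /and3P[_ nC _]].
  have hu a : a \in C -> (u.2 < a.2).
    move=> aC; have := allP hC a aC; have := nuC a aC; move: (u) (a); clear => -[u1 u2] [a1 a2].
    rewrite /ne_step xpair_eqE /=; lia.
  rewrite uv /=; apply/and3P; split.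
  - by apply/allP => a /hu /=; exact: ltn_trans.
  - by apply/allP => a /hu.
  apply: (sub_in_pairwise (P := mem C)) nC; last exact/allP.
  move=> a b aC bC; have := allP hC a aC; have := allP hC b bC; move: (u) (a) (b).
  by clear => -[u1 u2] [a1 a2] [b1 b2]; rewrite /ne_step xpair_eqE /=; lia.
- have : last u C \in u :: C by exact: mem_last.
  have : ne_step u y.
    move: pxs; rewrite e pairwise_cat /= => /and3P[_ _ /and4P[_ _ + _]].
    by rewrite all_cat /= => /and3P[].
  rewrite inE => /and3P[nuy _ _] /predU1P[->|/(allP hC)/eqP->]; move: hy nuy; clear; lia.
Qed.

(** In northeast order a row and then a column, which may stand on the last box of the row or apart
    from it. The last clause gives every nonempty shape a last row box. *)
Definition row_column (S X Y : seq cell) : Prop :=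
  exists r c, [/\ perm_eq (X ++ Y) S, pairwise ne_step (X ++ Y),
    all (fun x => x.1 == r) X, all (fun y => (y.1 < r) && (y.2 == c)) Y &
    (0 < size X) || nilp Y].

Definition column_row (S X Y : seq cell) : Prop :=
  exists r c, [/\ perm_eq (Y ++ X) S, pairwise ne_step (Y ++ X),
    all (fun x => (x.1 == r) && (c < x.2)) X, all (fun y => y.2 == c) Y &
    0 < size Y].

(** If the first two boxes share a row, [column_to_end] makes everything after that row a column; if
    they share a column, [row_to_end] does the opposite. If they share neither, the third box
    decides, and [bad_antichain] makes it share a row or a column with the second. *)
Lemma thin_structure S : uniq S -> thin S -> mfree S ->
  exists X Y, row_column S X Y \/ column_row S X Y.
Proof.
move=> uS tS mS; have [xs pS pxs] := thin_sorted uS tS.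
have cte l t z v u : xs = l ++ z :: v :: u :: t ->
    u.1 < v.1 -> z.2 < v.2 -> all (fun y => y.2 == u.2) t.
  by move=> e; move: pS pxs; rewrite e; exact: column_to_end.
have rte l t z v u : xs = l ++ z :: v :: u :: t ->
    v.2 < u.2 -> v.1 < z.1 -> all (fun y => y.1 == u.1) t.
  by move=> e; move: pS pxs; rewrite e; exact: row_to_end.
case: xs pS pxs cte rte => [|x1 [|x2 t]] pS pxs cte rte.
- by exists [::], [::]; left; exists 0, 0.
- by exists [:: x1], [::]; left; exists x1.1, 0; rewrite /= eqxx.
have n12 : ne_step x1 x2 by move: pxs => /= /andP[/andP[]].
have [e1|ne1] := eqVneq x1.1 x2.1.
  have [p [t2 [e hp ht]]] := split_prefix (fun x : cell => x.1 == x1.1) t.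
  exists (x1 :: x2 :: p), t2; left; exists x1.1, (if t2 is y :: _ then y.2 else 0).
  split; rewrite /= -?e // ?eqxx -?e1 //= ?eqxx //.
  case: t2 e ht => //= y t2 e hy; have [X0 [z [v eX]]] := last_two x1 x2 p.
  have hX x : x \in x1 :: x2 :: p -> x.1 == x1.1.
    by rewrite !inE => /or3P[/eqP->|/eqP->|/(allP hp)]; rewrite ?e1.
  have exs : x1 :: x2 :: t = X0 ++ z :: v :: y :: t2.
    by rewrite e -[_ :: _]/((x1 :: x2 :: p) ++ y :: t2) eX -catA.
  have pp : pairwise ne_step (X0 ++ z :: v :: y :: t2) by rewrite -exs.
  move: pp; rewrite pairwise_cat /= => /and3P[_ _ /and4P[/andP[nzv _] /andP[nvy nvt] nyt _]].
  have zr : z.1 == x1.1 by apply: hX; rewrite eX mem_cat !inE eqxx orbT.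
  have vr : v.1 == x1.1 by apply: hX; rewrite eX mem_cat !inE eqxx !orbT.
  have yv : y.1 < v.1 by move: nvy vr hy; rewrite /ne_step; case: (x1) (y) (v) => [? ?] [? ?] [? ?] /=; clear; lia.
  have zv : z.2 < v.2.
    move: nzv zr vr; case: (x1) (z) (v) => [? ?] [? ?] [? ?]; clear; rewrite /ne_step xpair_eqE /=; lia.
  have ht := cte _ _ _ _ _ exs yv zv.
  rewrite eqxx andbT; apply/andP; split; first by rewrite -(eqP vr).
  apply/allP => a a_t; rewrite (allP ht) // andbT.
  by have /and3P[+ _ _] := allP nyt a a_t; move: yv vr; case: (x1) (y) (v) (a) => [? ?] [? ?] [? ?] [? ?] /=; clear; lia.
have [e2|ne2] := eqVneq x1.2 x2.2.
  have [p [t2 [e hp ht]]] := split_prefix (fun x : cell => x.2 == x1.2) t.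
  exists t2, (x1 :: x2 :: p); right; exists (if t2 is y :: _ then y.1 else 0), x1.2.
  split; rewrite /= -?e // ?eqxx -?e2 //= ?eqxx //.
  case: t2 e ht => //= y t2 e hy; have [X0 [z [v eX]]] := last_two x1 x2 p.
  have hX x : x \in x1 :: x2 :: p -> x.2 == x1.2.
    by rewrite !inE => /or3P[/eqP->|/eqP->|/(allP hp)]; rewrite ?e2.
  have exs : x1 :: x2 :: t = X0 ++ z :: v :: y :: t2.
    by rewrite e -[_ :: _]/((x1 :: x2 :: p) ++ y :: t2) eX -catA.
  have pp : pairwise ne_step (X0 ++ z :: v :: y :: t2) by rewrite -exs.
  move: pp; rewrite pairwise_cat /= => /and3P[_ _ /and4P[/andP[nzv _] /andP[nvy nvt] nyt _]].
  have zr : z.2 == x1.2 by apply: hX; rewrite eX mem_cat !inE eqxx orbT.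
  have vr : v.2 == x1.2 by apply: hX; rewrite eX mem_cat !inE eqxx !orbT.
  have yv : v.2 < y.2 by move: nvy vr hy; rewrite /ne_step; case: (x1) (y) (v) => [? ?] [? ?] [? ?] /=; clear; lia.
  have zv : v.1 < z.1.
    move: nzv zr vr; case: (x1) (z) (v) => [? ?] [? ?] [? ?]; clear; rewrite /ne_step xpair_eqE /=; lia.
  have ht := rte _ _ _ _ _ exs yv zv.
  rewrite eqxx /=; apply/andP; split; first by rewrite -(eqP vr).
  apply/allP => a a_t; rewrite (allP ht) //=.
  by have /and3P[_ + _] := allP nyt a a_t; move: yv vr; case: (x1) (y) (v) (a) => [? ?] [? ?] [? ?] [? ?] /=; clear; lia.
have g1 : x2.1 < x1.1 by move: n12 ne1; rewrite /ne_step; case: (x1) (x2) => [? ?] [? ?] /=; clear; lia.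
have g2 : x1.2 < x2.2 by move: n12 ne2; rewrite /ne_step; case: (x1) (x2) => [? ?] [? ?] /=; clear; lia.
case: t pS pxs cte rte => [|x3 t] pS pxs cte rte.
  by exists [:: x1], [:: x2]; left; exists x1.1, x2.2; rewrite /= g1 !eqxx.
have n23 : ne_step x2 x3 by move: pxs => /= /and3P[_ /andP[]].
have nt : all (ne_step x3) t by move: pxs => /= /and4P[].
have [e1|ne1'] := eqVneq x2.1 x3.1.
  exists (x2 :: x3 :: t), [:: x1]; right; exists x2.1, x1.2.
  have h23 : x2.2 < x3.2.
    move: n23 e1; case: (x2) (x3) => [? ?] [? ?]; clear; rewrite /ne_step xpair_eqE /=; lia.
  have ht := rte [::] _ _ _ _ erefl h23 g1.
  split; rewrite //= ?e1 ?eqxx ?g2 //= (leq_trans g2) ?(ltnW h23) //=.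
  apply/allP => a a_t; rewrite (allP ht) //=.
  by have /and3P[_ + _] := allP nt a a_t; move: g2 h23; case: (x1) (x2) (x3) (a) => [? ?] [? ?] [? ?] [? ?] /=; clear; lia.
have [e2|ne2'] := eqVneq x2.2 x3.2.
  exists [:: x1], (x2 :: x3 :: t); left; exists x1.1, x2.2.
  have h23 : x3.1 < x2.1.
    move: n23 e2; case: (x2) (x3) => [? ?] [? ?]; clear; rewrite /ne_step xpair_eqE /=; lia.
  have ht := cte [::] _ _ _ _ erefl h23 g2.
  split; rewrite //= ?e2 ?eqxx ?g1 //= (ltn_trans h23) //=.
  apply/allP => a a_t; rewrite (allP ht) // andbT.
  by have /and3P[+ _ _] := allP nt a a_t; move: g1 h23; case: (x1) (x2) (x3) (a) => [? ?] [? ?] [? ?] [? ?] /=; clear; lia.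
case: (@bad_antichain S [::] t x1 x2 x3) => //.
  by move: n23 ne1'; rewrite /ne_step; case: (x2) (x3) => [? ?] [? ?] /=; clear; lia.
by move: n23 ne2'; rewrite /ne_step; case: (x2) (x3) => [? ?] [? ?] /=; clear; lia.
Qed.

(** * Words built as shuffles of a row and a column *)

Fixpoint shuffle (e : seq bool) (X Y : seq cell) : seq cell :=
  match e, X, Y with
  | true :: e', _, y :: Y' => y :: shuffle e' X Y'
  | false :: e', x :: X', _ => x :: shuffle e' X' Y
  | _, _, _ => [::]
  end.

Lemma shuffle_perm e X Y : count id e = size Y -> count negb e = size X ->
  perm_eq (shuffle e X Y) (X ++ Y).
Proof.
elim: e X Y => [|[] e IHe] X Y.
- by move/esym/size0nil=> ->; move/esym/size0nil=> ->.
- case: Y => //= y Y [hY] hX; rewrite perm_sym perm_catC /= perm_cons perm_catC perm_sym.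
  exact: IHe.
- by case: X => //= x X hY [hX]; rewrite perm_cons IHe.
Qed.

Lemma shuffle_all P e X Y : all P X -> all P Y -> all P (shuffle e X Y).
Proof.
elim: e X Y => [|[] e IHe] X Y //=.
  by case: Y => //= y Y hX /andP[-> hY]; exact: IHe.
by case: X => //= x X /andP[-> hX] hY; exact: IHe.
Qed.

Lemma shuffle_pairwise (r : rel cell) e X Y : pairwise r X -> pairwise r Y ->
  allrel r X Y -> allrel r Y X -> pairwise r (shuffle e X Y).
Proof.
elim: e X Y => [|[] e IHe] X Y //=.
  case: Y => //= y Y hX /andP[ry hY]; rewrite allrel_consr allrel_consl.
  by case/andP=> _ h1 /andP[h2 h3]; rewrite shuffle_all //= IHe.
case: X => //= x X /andP[rx hX] hY; rewrite allrel_consr allrel_consl.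
by case/andP=> h1 h2 /andP[_ h3]; rewrite shuffle_all //= IHe.
Qed.

Lemma shuffle_label (f : cell -> bool) e X Y :
  count id e = size Y -> count negb e = size X ->
  all (fun x => ~~ f x) X -> all f Y -> map f (shuffle e X Y) = e.
Proof.
elim: e X Y => [|[] e IHe] X Y //=.
  by case: Y => //= y Y [hY] hX fX /andP[-> fY]; rewrite IHe.
by case: X => //= x X hY [hX] /andP[/negPf-> fX] fY; rewrite IHe.
Qed.

Lemma pat_label_left (f : cell -> bool) (s : seq cell) x :
  pairwise (fun y z => ~~ ble z y && (below y z == f y)) (rcons s x) ->
  linear (rcons s x) /\ pat (rcons s x) = map f s.
Proof.
rewrite pairwise_relI => /andP[h1 /pairwise_sorted h2]; split=> //.
elim: s h2 {h1} => // y [|z s] IHs /=; first by rewrite andbT => /eqP->.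
by case/andP=> /eqP h1 /IHs; rewrite /pat /= h1 => ->.
Qed.

Lemma pat_label_right (f : cell -> bool) (s : seq cell) x :
  pairwise (fun y z => ~~ ble z y && (below y z == f z)) (x :: s) ->
  linear (x :: s) /\ pat (x :: s) = map f s.
Proof.
rewrite pairwise_relI => /andP[h1 /pairwise_sorted h2]; split=> //.
elim: s x h2 {h1} => // z s IHs x /= /andP[/eqP h1 /IHs].
by rewrite /pat /= h1 => ->.
Qed.


(** The column is a rectangle of width one with [(size C).+1] boxes, so the bound forces D^(size C)
    into [p]. *)
Lemma column_count (S : seq cell) (p : seq bool) (y : cell) C : convex S ->
  (forall k l, rc k l S <= prefixes_above (size S) (desc_asc k l) p) ->
  {subset y :: C <= S} -> pairwise ne_step (y :: C) ->
  all (fun z => z.2 == y.2) C -> size C <= count id p.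
Proof.
move=> cS hp CS pC hC.
have : (last y C).1 + size C <= y.1 /\ (last y C).2 = y.2.
  elim: C y pC hC {CS} => /= [|z C IHC] y; first by rewrite addn0.
  case/andP=> /andP[nyz _] pC /andP[hz hC].
  have [|h1 h2] := IHC z pC; first by rewrite (eqP hz).
  split; last by rewrite h2 (eqP hz).
  move: h1 nyz hz; case: (y) (z) (last z C) => [? ?] [? ?] [? ?].
  rewrite /ne_step xpair_eqE /=; clear; lia.
case=> h1 h2.
have yS : y \in S by apply: CS; exact: mem_head.
have lS : last y C \in S by apply: CS; exact: mem_last.
have : 0 < rc (size C) 0 S.
  rewrite -has_count; apply/hasP; exists y => //=.
  have le_C : size C <= y.1 by apply: leq_trans h1; exact: leq_addl.
  rewrite le_C subn0 /=; apply: cS lS yS _ _; rewrite /ble /= ?h2 ?leqnn ?andbT.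
    by rewrite leq_subRL // addnC.
  exact: leq_subr.
move=> /leq_trans/(_ (hp _ _)); rewrite -has_count => /hasP[v _].
rewrite /desc_asc cats0 => /(leq_count_subseq id); rewrite count_nseq mul1n => h3.
apply: leq_trans h3 _; rewrite -{2}(cat_take_drop v p) count_cat; exact: leq_addr.
Qed.

Lemma row_count (S : seq cell) (p : seq bool) (y : cell) C : convex S ->
  (forall k l, rc k l S <= prefixes_above (size S) (desc_asc k l) p) ->
  {subset y :: C <= S} -> pairwise ne_step (y :: C) ->
  all (fun z => z.1 == y.1) C -> size C <= count negb p.
Proof.
move=> cS hp CS pC hC.
have : y.2 + size C <= (last y C).2 /\ (last y C).1 = y.1.
  elim: C y pC hC {CS} => /= [|z C IHC] y; first by rewrite addn0.
  case/andP=> /andP[nyz _] pC /andP[hz hC].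
  have [|h1 h2] := IHC z pC; first by rewrite (eqP hz).
  split; last by rewrite h2 (eqP hz).
  move: h1 nyz hz; case: (y) (z) (last z C) => [? ?] [? ?] [? ?].
  rewrite /ne_step xpair_eqE /=; clear; lia.
case=> h1 h2.
have yS : y \in S by apply: CS; exact: mem_head.
have lS : last y C \in S by apply: CS; exact: mem_last.
have : 0 < rc 0 (size C) S.
  rewrite -has_count; apply/hasP; exists (last y C) => //=.
  have le_C : size C <= (last y C).2 by apply: leq_trans h1; exact: leq_addl.
  rewrite le_C subn0 /=; apply: cS yS lS _ _; rewrite /ble /= ?h2 ?leqnn ?andbT /=.
    by rewrite leq_subRL // addnC.
  exact: leq_subr.
move=> /leq_trans/(_ (hp _ _)); rewrite -has_count => /hasP[v _].
move/(leq_count_subseq negb); rewrite /= count_nseq mul1n => h3.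
apply: leq_trans h3 _; rewrite -{2}(cat_take_drop v p) count_cat; exact: leq_addr.
Qed.

(** The column, read downwards, lies above the row: the step after a column box is always a descent,
    the step after a row box never. So [p] labels all letters except the last, which is the right
    end [x] of the row or the foot [y0] of the column, according to whether [p] has as many descents
    as [Y] has boxes or one fewer. *)
Lemma row_column_occurs (S X Y : seq cell) (p : seq bool) : convex S ->
  size p = (size S).-1 ->
  (forall k l, rc k l S <= prefixes_above (size S) (desc_asc k l) p) ->
  row_column S X Y -> occurs S p.
Proof.
move=> cS szp hp [r [c [pS pXY hX hY]]].
have szS : size S = size X + size Y by rewrite -(perm_size pS) size_cat.
have cnt : count id p + count negb p = size p by rewrite -(count_predC id).
case/lastP: X pS pXY hX szS => [|X x] pS pXY hX szS nX.
  have Y0 : Y = [::] by apply/nilP.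
  rewrite Y0 in pS szS; exists [::]; first by rewrite /linext pS.
  by move: szp; rewrite szS => /size0nil.
move: (pXY); rewrite pairwise_cat => /and3P[/allrelP nXY pX pY].
have SX a : a \in rcons X x -> a \in S by rewrite -(perm_mem pS) mem_cat => ->.
have SY a : a \in Y -> a \in S by rewrite -(perm_mem pS) mem_cat orbC => ->.
have eX a : a \in rcons X x -> a.1 = r by move/(allP hX)/eqP.
have eY a : a \in Y -> a.1 < r /\ a.2 = c by move/(allP hY)/andP => -[? /eqP].
have cntF : size X <= count negb p.
  case: (X) pX SX eX => //= x0 X0 pX SX eX; rewrite -(size_rcons X0 x).
  apply: (row_count (y := x0) cS hp SX pX); apply/allP => a aX.
  by rewrite !eX ?inE ?eqxx ?aX ?orbT.
have cntT : (size Y).-1 <= count id p.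
  case: (Y) pY SY eY => //= y0 Y0 pY SY eY.
  apply: (column_count (y := y0) cS hp SY pY); apply/allP => a aY.
  have [|_ ->] := eY a; first by rewrite inE aY orbT.
  by have [|_ ->] := eY y0; first exact: mem_head.
pose R (a b : cell) := ~~ ble b a && (below a b == (a.1 < r)).
have RX : pairwise R (rcons X x).
  apply: (sub_in_pairwise (P := mem (rcons X x))) pX; last exact/allP.
  move=> a b /eX + /eX; rewrite /R /ne_step /ble /below.
  case: a b => [a1 a2] [b1 b2]; rewrite xpair_eqE /=; clear; lia.
have RY : pairwise R (rev Y).
  rewrite pairwise_rev; apply: (sub_in_pairwise (P := mem Y)) pY; last exact/allP.
  move=> a b /eY + /eY; rewrite /R /ne_step /ble /below.
  case: a b => [a1 a2] [b1 b2]; rewrite xpair_eqE /=; clear => -[? ?] [? ?]; lia.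
have RYX a b : a \in Y -> b \in rcons X x -> R a b.
  move=> /eY + /eX; rewrite /R /ble /below.
  case: a b => [a1 a2] [b1 b2] /=; clear => -[? ?] ?; lia.
have RXY a b : a \in rcons X x -> b \in Y -> a.2 < c -> R a b.
  move=> /eX + /eY; rewrite /R /ble /below.
  case: a b => [a1 a2] [b1 b2] /=; clear => ? [? ?]; lia.
have fin w z : perm_eq (rcons w z) (rcons X x ++ Y) -> pairwise R (rcons w z) ->
    map (fun a : cell => a.1 < r) w = p -> occurs S p.
  move=> pw /pat_label_left[lw <-] <-; exists (rcons w z) => //.
  by rewrite /linext lw andbT; apply: perm_trans pS.
have X0c a : a \in X -> Y != [::] -> a.2 < c.
  move=> aX; case: (Y) nXY eY => // y0 Y0 nXY eY _.
  have xX : x \in rcons X x by rewrite mem_rcons mem_head.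
  have y0Y : y0 \in y0 :: Y0 by exact: mem_head.
  have aX' : a \in rcons X x by rewrite mem_rcons inE aX orbT.
  have := nXY _ _ xX y0Y; have := (eY _ y0Y).2.
  have : ne_step a x by move: pX; rewrite pairwise_rcons => /andP[/allP/(_ a aX)].
  have := eX _ xX; have := eX _ aX'; rewrite /ne_step.
  case: (a) (x) (y0) => [a1 a2] [b1 b2] [c1 c2]; rewrite !xpair_eqE /=; clear; lia.
rewrite size_rcons in szS.
have [eT|neT] := eqVneq (count id p) (size Y).
  have eF : count negb p = size X by move: szp cnt; rewrite szS eT; clear; lia.
  have szr : count id p = size (rev Y) by rewrite size_rev.
  apply: (fin (shuffle p X (rev Y)) x).
  - rewrite -!cats1 perm_sym perm_catAC perm_sym perm_cat2r.
    apply: perm_trans (shuffle_perm szr eF) _; rewrite perm_cat2l; exact: permEl (perm_rev _).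
  - rewrite pairwise_rcons; move: RX; rewrite pairwise_rcons => /andP[RX1 RX2].
    rewrite shuffle_all //=; last first.
      by apply/allP => a; rewrite mem_rev => aY; apply: RYX => //; rewrite mem_rcons mem_head.
    apply: shuffle_pairwise => //; apply/allrelP => a b; rewrite mem_rev.
      move=> aX bY; apply: RXY => //; first by rewrite mem_rcons inE aX orbT.
      by apply: X0c => //; case: (Y) bY.
    by move=> aY bX; apply: RYX => //; rewrite mem_rcons inE bX orbT.
  - apply: shuffle_label => //; apply/allP => a.
      by move=> aX; rewrite eX ?ltnn // mem_rcons inE aX orbT.
    by rewrite mem_rev => /eY[].
case: Y => [|y0 Y] in pS nX pXY hY szS nXY pY SY eY cntT RY RYX RXY fin X0c neT *.
  by move: szp cnt cntF neT; rewrite szS /=; clear; lia.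
have eT : count id p = size Y.
  by move: szp cnt cntF cntT neT; rewrite szS /=; clear; lia.
have eF : count negb p = size (rcons X x).
  by move: szp cnt; rewrite szS eT size_rcons /=; clear; lia.
(* If [x] stood in column [c], this column would have one more box, and [column_count] would demand
   one more descent than [p] has. *)
have xc : x.2 < c.
  have xX : x \in rcons X x by rewrite mem_rcons mem_head.
  have := nXY _ _ xX (mem_head _ _); have [yr yc] := eY _ (mem_head y0 Y).
  case/and3P=> _; rewrite yc leq_eqVlt => /predU1P[xc _|//].
  have : size (y0 :: Y) <= count id p.
    apply: (column_count (y := x) cS hp).
    - by move=> a; rewrite inE => /predU1P[->|/SY //]; exact: SX.
    - by rewrite pairwise_cons pY andbT; apply/allP => a aY; exact: nXY.
    - by apply/allP => a /eY[_ ->]; rewrite xc.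
  by rewrite eT ltnn.
have szr : count id p = size (rev Y) by rewrite size_rev.
have YY a : a \in Y -> a \in y0 :: Y by move=> aY; rewrite inE aY orbT.
have Xc a : a \in rcons X x -> a.2 < c.
  by rewrite mem_rcons inE => /predU1P[->//|aX]; exact: X0c.
move: RY; rewrite rev_cons pairwise_rcons => /andP[RY1 RY2].
apply: (fin (shuffle p (rcons X x) (rev Y)) y0).
- rewrite -cats1 perm_catC /= perm_sym perm_catC /= perm_cons perm_catC perm_sym.
  apply: perm_trans (shuffle_perm szr eF) _; rewrite perm_cat2l; exact: permEl (perm_rev _).
- rewrite pairwise_rcons shuffle_all //=; last first.
    by apply/allP => a aX; apply: RXY => //; [exact: mem_head|exact: Xc].
  apply: shuffle_pairwise => //; apply/allrelP => a b; rewrite mem_rev.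
    by move=> aX /YY bY; apply: RXY => //; exact: Xc.
  by move=> /YY aY bX; exact: RYX.
- apply: shuffle_label => //; apply/allP => a; first by move=> aX; rewrite eX ?ltnn.
  by rewrite mem_rev => /YY/eY[].
Qed.

(** Now the later letter decides: a step is a descent exactly when it leads to a column box. The
    free letter is the first one, the top [y] of the column or the left end [x] of the row. *)
Lemma column_row_occurs (S X Y : seq cell) (p : seq bool) : convex S ->
  size p = (size S).-1 ->
  (forall k l, rc k l S <= prefixes_above (size S) (desc_asc k l) p) ->
  column_row S X Y -> occurs S p.
Proof.
move=> cS szp hp [r [c [pS pXY hX hY]]].
have szS : size S = size Y + size X by rewrite -(perm_size pS) size_cat.
have cnt : count id p + count negb p = size p by rewrite -(count_predC id).
case/lastP: Y pS pXY hY szS => // Y y pS pXY hY szS _.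
move: (pXY); rewrite pairwise_cat => /and3P[/allrelP nYX pY pX].
have SY a : a \in rcons Y y -> a \in S by rewrite -(perm_mem pS) mem_cat => ->.
have SX a : a \in X -> a \in S by rewrite -(perm_mem pS) mem_cat orbC => ->.
have eY a : a \in rcons Y y -> a.2 = c by move/(allP hY)/eqP.
have eX a : a \in X -> a.1 = r /\ c < a.2 by move/(allP hX)/andP => -[/eqP].
have yY : y \in rcons Y y by rewrite mem_rcons mem_head.
have YY a : a \in Y -> a \in rcons Y y by move=> aY; rewrite mem_rcons inE aY orbT.
have cntT : size Y <= count id p.
  case: (Y) pY SY eY => //= y0 Y0 pY SY eY; rewrite -(size_rcons Y0 y).
  apply: (column_count (y := y0) cS hp SY pY); apply/allP => a aY.
  by rewrite !eY ?inE ?eqxx ?aY ?orbT.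
have cntF : (size X).-1 <= count negb p.
  case: (X) pX SX eX => //= x0 X0 pX SX eX.
  apply: (row_count (y := x0) cS hp SX pX); apply/allP => a aX.
  have [|-> _] := eX a; first by rewrite inE aX orbT.
  by have [|-> _] := eX x0; first exact: mem_head.
pose R (a b : cell) := ~~ ble b a && (below a b == (b.2 == c)).
have RX : pairwise R X.
  apply: (sub_in_pairwise (P := mem X)) pX; last exact/allP.
  move=> a b /eX + /eX; rewrite /R /ne_step /ble /below.
  case: a b => [a1 a2] [b1 b2]; rewrite xpair_eqE /=; clear => -[? ?] [? ?]; lia.
have RY : pairwise R (rev (rcons Y y)).
  rewrite pairwise_rev; apply: (sub_in_pairwise (P := mem (rcons Y y))) pY; last exact/allP.
  move=> a b /eY + /eY; rewrite /R /ne_step /ble /below.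
  case: a b => [a1 a2] [b1 b2]; rewrite xpair_eqE /=; clear; lia.
have RYX a b : a \in rcons Y y -> b \in X -> R a b.
  move=> aY bX; have := nYX _ _ aY bX; move: aY bX; move=> /eY + /eX.
  rewrite /R /ne_step /ble /below.
  case: a b => [a1 a2] [b1 b2]; rewrite xpair_eqE /=; clear => ? [? ?]; lia.
have RXY a b : a \in X -> b \in rcons Y y -> r < b.1 -> R a b.
  move=> /eX + /eY; rewrite /R /ble /below.
  case: a b => [a1 a2] [b1 b2] /=; clear => -[? ?] ?; lia.
have fin w z : perm_eq (z :: w) (rcons Y y ++ X) -> pairwise R (z :: w) ->
    map (fun a : cell => a.2 == c) w = p -> occurs S p.
  move=> pw /(pat_label_right (f := fun a : cell => a.2 == c))[lw <-] <-.
  by exists (z :: w) => //; rewrite /linext lw andbT; apply: perm_trans pS.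
have Y0r a : a \in Y -> X != [::] -> r < a.1.
  move=> aY; case: (X) nYX eX => // x0 X0 nYX eX _.
  have x0X : x0 \in x0 :: X0 by exact: mem_head.
  have := nYX _ _ yY x0X; have := (eX _ x0X).1.
  have : ne_step a y by move: pY; rewrite pairwise_rcons => /andP[/allP/(_ a aY)].
  have := eY _ yY; have := eY _ (YY _ aY); rewrite /ne_step.
  case: (a) (y) (x0) => [a1 a2] [b1 b2] [c1 c2]; rewrite !xpair_eqE /=; clear; lia.
rewrite size_rcons in szS.
have [eT|neT] := eqVneq (count id p) (size Y).
  have eF : count negb p = size X by move: szp cnt; rewrite szS eT; clear; lia.
  have szr : count id p = size (rev Y) by rewrite size_rev.
  move: RY; rewrite rev_rcons /= => /andP[RY1 RY2].
  apply: (fin (shuffle p X (rev Y)) y).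
  - rewrite -cats1 -catA perm_sym perm_catC -catA perm_sym /= perm_cons.
    apply: perm_trans (shuffle_perm szr eF) _; rewrite perm_cat2l; exact: permEl (perm_rev _).
  - rewrite pairwise_cons shuffle_all //=; last first.
      by apply/allP => a aX; exact: RYX.
    apply: shuffle_pairwise => //; apply/allrelP => a b; rewrite mem_rev.
      move=> aX bY; apply: RXY => //; first exact: YY.
      by apply: Y0r => //; case: (X) aX.
    by move=> /YY aY bX; exact: RYX.
  - apply: shuffle_label => //; apply/allP => a.
      by move=> /eX[_]; rewrite neq_ltn orbC => ->.
    by rewrite mem_rev => /YY/eY->.
case: X => [|x X] in pS pXY hX szS nYX pX SX eX cntF RX RYX RXY fin Y0r neT *.
  by move: szp cnt cntT neT; rewrite szS /=; clear; lia.
have eT : count id p = (size Y).+1.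
  by move: szp cnt cntF cntT neT; rewrite szS /=; clear; lia.
have eF : count negb p = size X.
  by move: szp cnt; rewrite szS eT /=; clear; lia.
have yr : r < y.1.
  have := nYX _ _ yY (mem_head _ _); have [xr xc] := eX _ (mem_head x X).
  case/and3P; rewrite xr leq_eqVlt => /predU1P[ry _ _|//].
  have : size (x :: X) <= count negb p.
    apply: (row_count (y := y) cS hp).
    - by move=> a; rewrite inE => /predU1P[->|/SX //]; exact: SY.
    - by rewrite pairwise_cons pX andbT; apply/allP => a aX; exact: nYX.
    - by apply/allP => a /eX[-> _]; rewrite ry.
  by rewrite eF ltnn.
have szr : count id p = size (rev (rcons Y y)) by rewrite size_rev size_rcons.
have XX a : a \in X -> a \in x :: X by move=> aX; rewrite inE aX orbT.
have Yr a : a \in rcons Y y -> r < a.1.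
  by rewrite mem_rcons inE => /predU1P[->//|aY]; exact: Y0r.
move: RX => /= /andP[RX1 RX2].
apply: (fin (shuffle p X (rev (rcons Y y))) x).
- rewrite perm_sym perm_catC /= perm_cons perm_sym.
  apply: perm_trans (shuffle_perm szr eF) _; rewrite perm_cat2l; exact: permEl (perm_rev _).
- rewrite pairwise_cons shuffle_all //=; last first.
    by apply/allP => a; rewrite mem_rev => aY; apply: RXY => //; [exact: mem_head|exact: Yr].
  apply: shuffle_pairwise => //; apply/allrelP => a b; rewrite mem_rev.
    by move=> /XX aX bY; apply: RXY => //; exact: Yr.
  by move=> aY /XX bX; exact: RYX.
- apply: shuffle_label => //; apply/allP => a.
    by move=> /XX/eX[_]; rewrite neq_ltn orbC => ->.
  by rewrite mem_rev => /eY->.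
Qed.

Lemma thin_occurs (S : seq cell) (p : seq bool) : convex S -> uniq S -> thin S ->
  mfree S -> size p = (size S).-1 ->
  (forall k l, rc k l S <= prefixes_above (size S) (desc_asc k l) p) ->
  occurs S p.
Proof.
move=> cS uS tS mS szp hp; have [X [Y [h|h]]] := thin_structure uS tS mS.
  exact: row_column_occurs h.
exact: column_row_occurs h.
Qed.

(** * Shapes with a 2 x 2 square *)

Ltac each_in := rewrite ?inE;
  first [ case/or4P => /eqP-> | case/or4P => [/eqP->|/eqP->|/eqP->|/orP[]/eqP->]
        | case/or4P => [/eqP->|/eqP->|/eqP->|/or3P[]/eqP->] ].
Ltac window_uniq := rewrite /= !inE !xpair_eqE; lia.
Ltac window_sub := move=> ?; each_in.
Ltac window_convex :=
  move=> ? ? [? ?]; each_in; each_in; rewrite /ble ?inE !xpair_eqE /= => _; lia.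
Ltac window_perm := apply/permP => P /=; clear; lia.
Ltac window_linear := rewrite /linear /ble /=; lia.
Ltac window_pat := rewrite /pat /below /=; repeat (apply: (congr2 cons); first lia); reflexivity.

Definition square (S : seq cell) (r k : nat) : Prop :=
  [/\ (r, k) \in S, (r, k.+1) \in S, (r.+1, k) \in S & (r.+1, k.+1) \in S].

(** The box [(i, j)] is incomparable to the square and trades places with [(r.+1, k)]; both words
    read D N D N. *)
Lemma square_southwest (S : seq cell) (r k i j : nat) : uniq S -> mfree S ->
  square S r k -> (i, j) \in S -> r.+1 < i -> j < k -> False.
Proof.
move=> uS mS [aS bS cS' dS] zS lt_i lt_j.
suff [] : [:: (r, k); (r.+1, k); (r, k.+1); (i, j); (r.+1, k.+1)]
        = [:: (r, k); (i, j); (r, k.+1); (r.+1, k); (r.+1, k.+1)] :> seq cell.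
  by move: lt_j; clear; lia.
apply: (mfree_window uS mS (V := [:: (r, k); (r, k.+1); (r.+1, k); (r.+1, k.+1); (i, j)])).
all: move: lt_i lt_j => // lt_i lt_j; clear - lt_i lt_j aS bS cS' dS zS.
- clear - lt_i lt_j; window_uniq.
- window_sub => //.
- clear - lt_i lt_j; window_convex.
- window_perm.
- window_perm.
- clear - lt_i lt_j; window_linear.
- clear - lt_i lt_j; window_linear.
- clear - lt_i lt_j; window_pat.
Qed.

Lemma square_northeast (S : seq cell) (r k i j : nat) : uniq S -> mfree S ->
  square S r k -> (i, j) \in S -> i < r -> k.+1 < j -> False.
Proof.
move=> uS mS [aS bS cS' dS] zS lt_i lt_j.
suff [] : [:: (r, k); (i, j); (r.+1, k); (r, k.+1); (r.+1, k.+1)]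
        = [:: (r, k); (r, k.+1); (r.+1, k); (i, j); (r.+1, k.+1)] :> seq cell.
  by move: lt_j; clear; lia.
apply: (mfree_window uS mS (V := [:: (r, k); (r, k.+1); (r.+1, k); (r.+1, k.+1); (i, j)])).
all: move: lt_i lt_j => // lt_i lt_j; clear - lt_i lt_j aS bS cS' dS zS.
- clear - lt_i lt_j; window_uniq.
- window_sub => //.
- clear - lt_i lt_j; window_convex.
- window_perm.
- window_perm.
- clear - lt_i lt_j; window_linear.
- clear - lt_i lt_j; window_linear.
- clear - lt_i lt_j; window_pat.
Qed.

(** If [(r.+1, k.+2)] is present, both words read D N D N. If not, both read N D N but end in
    different rows; only a later box of row [r.+1] could notice this, and that row stops at column
    [k.+1]. *)
Lemma corner_free (S : seq cell) (r k : nat) : convex S -> uniq S -> mfree S ->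
  square S r k -> (r, k.+2) \in S -> (r.+2, k) \in S -> False.
Proof.
move=> cvS uS mS [aS bS cS' dS] eS fS.
have [qS|nqS] := boolP ((r.+1, k.+2) \in S).
{ suff [] : [:: (r, k.+1); (r.+1, k.+1); (r, k.+2); (r.+2, k); (r.+1, k.+2)]
          = [:: (r, k.+1); (r.+2, k); (r, k.+2); (r.+1, k.+1); (r.+1, k.+2)] :> seq cell.
    by clear; lia.
  apply: (mfree_window uS mS
    (V := [:: (r, k.+1); (r.+1, k.+1); (r, k.+2); (r.+2, k); (r.+1, k.+2)])) => //.
  all: clear - aS bS cS' dS eS fS qS.
  - clear; window_uniq.
  - window_sub => //.
  - clear; window_convex.
  - window_perm.
  - clear; window_linear.
  - clear; window_linear.
  - clear; window_pat.
}
suff [] : [:: (r.+1, k); (r, k.+2); (r.+2, k); (r.+1, k.+1)]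
        = [:: (r.+1, k); (r.+1, k.+1); (r.+2, k); (r, k.+2)] :> seq cell.
  by clear; lia.
apply: (mfree_window uS mS
  (V := [:: (r.+1, k); (r, k.+2); (r.+2, k); (r.+1, k.+1)])) => //.
1-6: clear - aS bS cS' dS eS fS.
- clear; window_uniq.
- window_sub => //.
- clear; window_convex.
- window_perm.
- clear; window_linear.
- clear; window_linear.
- clear; window_pat.
move=> [x1 x2] h xS _ /hasPn nb; rewrite /below /=.
have ne : x1 <> r.+1.
  move=> ex; have := nb (r.+1, k.+1); rewrite !inE eqxx !orbT => /(_ isT).
  rewrite /ble /= ex leqnn /= -ltnNge => lt_x; case/negP: nqS.
  by apply: cvS dS xS _ _; rewrite /ble /= ?ex; move: lt_x; clear; lia.
move: ne; clear; lia.
Qed.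

Lemma corner_free_rot (S : seq cell) (r k : nat) : convex S -> uniq S -> mfree S ->
  square S r.+1 k.+1 -> (r, k.+2) \in S -> (r.+2, k) \in S -> False.
Proof.
move=> cvS uS mS [dS cS' bS aS] fS eS.
have [pS|npS] := boolP ((r.+1, k) \in S).
{ suff [] : [:: (r.+1, k); (r, k.+2); (r.+2, k); (r.+1, k.+1); (r.+2, k.+1)]
          = [:: (r.+1, k); (r.+1, k.+1); (r.+2, k); (r, k.+2); (r.+2, k.+1)] :> seq cell.
    by clear; lia.
  apply: (mfree_window uS mS
    (V := [:: (r.+1, k); (r, k.+2); (r.+2, k); (r.+1, k.+1); (r.+2, k.+1)])) => //.
  all: clear - aS bS cS' dS eS fS pS.
  - clear; window_uniq.
  - window_sub => //.
  - clear; window_convex.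
  - window_perm.
  - clear; window_linear.
  - clear; window_linear.
  - clear; window_pat.
}
suff [] : [:: (r.+1, k.+1); (r, k.+2); (r.+2, k); (r.+1, k.+2)]
        = [:: (r.+2, k); (r, k.+2); (r.+1, k.+1); (r.+1, k.+2)] :> seq cell.
  by clear; lia.
apply: (mfree_window uS mS
  (V := [:: (r.+1, k.+1); (r, k.+2); (r.+2, k); (r.+1, k.+2)])) => //.
1-6: clear - aS bS cS' dS eS fS.
- clear; window_uniq.
- window_sub => //.
- clear; window_convex.
- window_perm.
- clear; window_linear.
- clear; window_linear.
- clear; window_pat.
move=> [x1 x2] h xS nV hb; rewrite /below /=.
have ne : x1 <> r.+1.
  move=> ex; move: nV hb; rewrite !inE !xpair_eqE /ble /= => nV hb.
  case/negP: npS; apply: cvS xS eS _ _; rewrite /ble /=; move: nV hb; rewrite ex; clear; lia.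
move: ne; clear; lia.
Qed.

(** Both words read N N D N. They end in rows [r.+1] and [r], which a later box could tell apart
    only in row [r.+1], and this row ends at [t.+2]. *)
Lemma two_rows_right (S : seq cell) (r t : nat) : uniq S -> mfree S ->
  [/\ (r.+1, t) \in S, (r.+1, t.+1) \in S & (r.+1, t.+2) \in S] ->
  (r, t.+2) \in S -> (r, t.+3) \in S ->
  (forall j, (r.+1, j) \in S -> j <= t.+2) -> False.
Proof.
move=> uS mS [aS bS cS'] dS eS hr.
suff [] : [:: (r.+1, t); (r, t.+2); (r, t.+3); (r.+1, t.+1); (r.+1, t.+2)]
        = [:: (r.+1, t); (r.+1, t.+1); (r, t.+2); (r.+1, t.+2); (r, t.+3)] :> seq cell.
  by clear; lia.
apply: (mfree_window uS mS
  (V := [:: (r.+1, t); (r, t.+2); (r, t.+3); (r.+1, t.+1); (r.+1, t.+2)])) => //.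
1-6: clear - aS bS cS' dS eS.
- clear; window_uniq.
- window_sub => //.
- clear; window_convex.
- window_perm.
- clear; window_linear.
- clear; window_linear.
- clear; window_pat.
move=> [x1 x2] h xS nV hb; rewrite /below /=.
have ne : x1 <> r.+1.
  move=> ex; move: nV hb (hr x2); rewrite -ex xS !inE !xpair_eqE /ble /= ex.
  by clear => ? ? /(_ isT); lia.
move: ne; clear; lia.
Qed.

Lemma two_rows_left (S : seq cell) (r t : nat) : uniq S -> mfree S ->
  [/\ (r, t.+1) \in S, (r, t.+2) \in S & (r, t.+3) \in S] ->
  (r.+1, t) \in S -> (r.+1, t.+1) \in S ->
  (forall j, (r, j) \in S -> t < j) -> False.
Proof.
move=> uS mS [aS bS cS'] dS eS hr.
suff [] : [:: (r, t.+1); (r, t.+2); (r.+1, t); (r.+1, t.+1); (r, t.+3)]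
        = [:: (r.+1, t); (r, t.+1); (r.+1, t.+1); (r, t.+2); (r, t.+3)] :> seq cell.
  by clear; lia.
apply: (mfree_window uS mS
  (V := [:: (r, t.+1); (r, t.+2); (r.+1, t); (r.+1, t.+1); (r, t.+3)])) => //.
1-6: clear - aS bS cS' dS eS.
- clear; window_uniq.
- window_sub => //.
- clear; window_convex.
- window_perm.
- clear; window_linear.
- clear; window_linear.
- clear; window_pat.
move=> [x1 x2] h xS nV hb; rewrite /below /=.
have ne : x1 <> r.
  move=> ex; move: nV hb (hr x2); rewrite -ex xS !inE !xpair_eqE /ble /= ex.
  by clear => ? ? /(_ isT); lia.
move: ne; clear; lia.
Qed.

(** Both words read N N D N N. Two equal rows contain this configuration as soon as they have five
    boxes, whence the bound 5 in [two_rows_class]. *)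
Lemma two_rows_long (S : seq cell) (r t : nat) : uniq S -> mfree S ->
  [/\ (r.+1, t) \in S, (r.+1, t.+1) \in S & (r.+1, t.+2) \in S] ->
  [/\ (r, t.+2) \in S, (r, t.+3) \in S & (r, t.+4) \in S] -> False.
Proof.
move=> uS mS [aS bS cS'] [dS eS fS].
suff [] : [:: (r.+1, t); (r, t.+2); (r, t.+3); (r.+1, t.+1); (r.+1, t.+2); (r, t.+4)]
        = [:: (r.+1, t); (r.+1, t.+1); (r, t.+2); (r.+1, t.+2); (r, t.+3); (r, t.+4)] :> seq cell.
  by clear; lia.
apply: (mfree_window uS mS (V :=
  [:: (r.+1, t); (r, t.+2); (r, t.+3); (r.+1, t.+1); (r.+1, t.+2); (r, t.+4)])) => //.
all: clear - aS bS cS' dS eS fS.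
- clear; window_uniq.
- window_sub => //.
- clear; window_convex.
- window_perm.
- clear; window_linear.
- clear; window_linear.
- clear; window_pat.
Qed.

Lemma thin_or_square (S : seq cell) : convex S ->
  thin S \/ exists r k, square S r k.
Proof.
move=> cS; have [h|] := boolP (all (fun x => all (fun y =>
  (x.1 < y.1) ==> (y.2 <= x.2)) S) S).
  by left=> x y xS yS; move/allP: h => /(_ x xS)/allP/(_ y yS)/implyP.
case/allPn=> -[r k] aS /allPn[[i j] bS]; rewrite negb_imply /= -ltnNge => /andP[ri kj].
right; exists r, k; split=> //; apply: cS aS bS _ _; rewrite /ble /=; move: ri kj; clear; lia.
Qed.

(** A box outside the two rows yields, by convexity, one directly below or above the square
    ([hrow]), and a box outside the two columns one directly beside it ([hcol]). Each of the four
    combinations is a forbidden configuration. *)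
Lemma two_rows_or_columns (S : seq cell) r k :
  convex S -> uniq S -> mfree S -> square S r k ->
  (forall x, x \in S -> r <= x.1 <= r.+1) \/ (forall x, x \in S -> k <= x.2 <= k.+1).
Proof.
move=> cvS uS mS sq; have [aS bS cS dS] := sq.
have [h|] := boolP (all (fun x : cell => r <= x.1 <= r.+1) S); first by left; exact/allP.
case/allPn=> -[i j] ijS /= out_i.
have [h|] := boolP (all (fun x : cell => k <= x.2 <= k.+1) S); first by right; exact/allP.
case/allPn=> -[i' j'] ijS' /= out_j; exfalso.
have hrow : (r.+2, k) \in S \/ 0 < r /\ (r.-1, k.+1) \in S.
  have [lt_i|le_i] := ltnP r.+1 i.
    left; have [lt_j|le_j] := ltnP j k; first by case: (square_southwest uS mS sq ijS).
    by apply: cvS cS ijS _ _; rewrite /ble /= ?leqnn ?leqnSn ?lt_i.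
  have lt_i : i < r by move: out_i le_i; clear; lia.
  right; split; first exact: leq_ltn_trans lt_i.
  have [lt_j|le_j] := ltnP k.+1 j; first by case: (square_northeast uS mS sq ijS).
  by apply: cvS ijS bS _ _; rewrite /ble /=; move: lt_i le_j; clear; lia.
have hcol : (r, k.+2) \in S \/ 0 < k /\ (r.+1, k.-1) \in S.
  have [lt_j|le_j] := ltnP k.+1 j'.
    left; have [lt_i|le_i] := ltnP i' r; first by case: (square_northeast uS mS sq ijS').
    by apply: cvS bS ijS' _ _; rewrite /ble /= ?leqnn ?leqnSn ?lt_j ?andbT.
  have lt_j : j' < k by move: out_j le_j; clear; lia.
  right; split; first exact: leq_ltn_trans lt_j.
  have [lt_i|le_i] := ltnP r.+1 i'; first by case: (square_southwest uS mS sq ijS').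
  by apply: cvS ijS' cS _ _; rewrite /ble /=; move: lt_j le_i; clear; lia.
case: hrow hcol => [fS|[r0 fS]] [eS|[k0 eS]].
- exact: corner_free cvS uS mS sq eS fS.
- apply: (square_southwest (i := r.+2) (j := k.-1) uS mS sq) => //; last by rewrite prednK.
  by apply: cvS eS fS _ _; rewrite /ble /= ?leqnn ?leqnSn ?leq_pred.
- apply: (square_northeast (i := r.-1) (j := k.+2) uS mS sq) => //; last by rewrite prednK.
  by apply: cvS fS eS _ _; rewrite /ble /= ?leqnn ?leqnSn ?leq_pred.
case: r k r0 k0 sq fS eS {aS bS cS dS out_i out_j} => [|r] // [|k] // _ _ sq fS eS.
exact: corner_free_rot cvS uS mS sq fS eS.
Qed.

(** * Classification of two-row shapes *)

Definition two_rows (r c1 n1 c2 n2 : nat) : seq cell :=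
  [seq (r, j) | j <- iota c1 n1] ++ [seq (r.+1, j) | j <- iota c2 n2].

Lemma mem_two_rows r c1 n1 c2 n2 i j : ((i, j) \in two_rows r c1 n1 c2 n2) =
  (i == r) && (c1 <= j < c1 + n1) || (i == r.+1) && (c2 <= j < c2 + n2).
Proof.
rewrite mem_cat; congr (_ || _).
  apply/mapP/andP => [[t + [-> ->]]|[/eqP-> h]]; first by rewrite mem_iota eqxx.
  by exists j => //; rewrite mem_iota.
apply/mapP/andP => [[t + [-> ->]]|[/eqP-> h]]; first by rewrite mem_iota eqxx.
by exists j => //; rewrite mem_iota.
Qed.

Lemma uniq_two_rows r c1 n1 c2 n2 : uniq (two_rows r c1 n1 c2 n2).
Proof.
rewrite cat_uniq !map_inj_uniq ?iota_uniq //=; try by move=> ? ? [].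
rewrite andbT; apply/hasPn => _ /mapP[j _ ->]; apply/negP => /mapP[? _ []].
by clear; lia.
Qed.

Lemma row_interval (S : seq cell) r k : convex S -> (r, k) \in S ->
  exists c n, forall j, ((r, j) \in S) = (c <= j < c + n).
Proof.
move=> cvS kS; have ex : exists j, (r, j) \in S by exists k.
have ub j : (r, j) \in S -> j <= sumn (map snd S).
  by move=> jS; apply: leq_sumn; apply/mapP; exists (r, j).
case: (ex_minnP ex) => c cS hc; case: (ex_maxnP ex ub) => d dS hd.
exists c, (d.+1 - c) => j; rewrite subnKC ?ltnS; last exact: leqW (hc _ dS).
apply/idP/idP => [jS|/andP[cj jd]]; first by rewrite hc ?hd.
by apply: cvS cS dS _ _; rewrite /ble /= leqnn.
Qed.

(** If the upper row ends later, [two_rows_right] leaves two boxes in the lower row; if the lower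
    row starts earlier, [two_rows_left] leaves two in the upper row; otherwise the rows have the
    same columns. *)
Lemma two_rows_class (S : seq cell) r k : convex S -> uniq S -> mfree S ->
  square S r k -> (forall x, x \in S -> r <= x.1 <= r.+1) ->
  exists c m, [\/ perm_eq S (two_rows r c m.+2 c 2), perm_eq S (two_rows r (c + m) 2 c m.+2)
    | perm_eq S (two_rows r c m c m) /\ 2 < m < 5].
Proof.
move=> cvS uS mS [aS bS cS dS] hS.
have [c1 [n1 h1]] := row_interval cvS aS; have [c2 [n2 h2]] := row_interval cvS cS.
have mem_S i j : (i, j) \in S =
    (i == r) && (c1 <= j < c1 + n1) || (i == r.+1) && (c2 <= j < c2 + n2).
  have [->|nr] := eqVneq i r; first by rewrite h1 /= orbC ltn_eqF.
  have [->|nr'] := eqVneq i r.+1; first by rewrite h2.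
  by apply/negP => /hS /=; move: nr nr'; clear; lia.
move: (aS) (bS) (cS) (dS); rewrite !h1 !h2 => a1 b1 a2 b2.
have le_c : c2 <= c1.
  have : (r.+1, c1) \in S.
    apply: (@cvS (r, c1) (r.+1, k)); rewrite ?h1 ?h2 /ble /=; move: a1 a2; clear; lia.
  by rewrite h2 => /andP[].
have le_d : c2 + n2 <= c1 + n1.
  have : (r, (c2 + n2).-1) \in S.
    apply: (@cvS (r, k) (r.+1, (c2 + n2).-1)); rewrite ?h1 ?h2 /ble /=; move: a1 a2; clear; lia.
  by rewrite h1 => /andP[_]; move: a2; clear; lia.
have fin c1' n1' c2' n2' : c1 = c1' -> n1 = n1' -> c2 = c2' -> n2 = n2' ->
    perm_eq S (two_rows r c1' n1' c2' n2').
  move=> <- <- <- <-; apply: uniq_perm => //; first exact: uniq_two_rows.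
  by move=> [i j]; rewrite mem_S mem_two_rows.
have [lt_d|ge_d] := ltnP (c2 + n2) (c1 + n1).
  have n2_2 : n2 <= 2.
    rewrite leqNgt; apply/negP => lt2.
    apply: (@two_rows_right S r (c2 + n2 - 3) uS mS).
    - split; rewrite h2; move: lt2; clear; lia.
    - rewrite h1; move: lt2 lt_d b1 b2; clear; lia.
    - rewrite h1; move: lt2 lt_d b1 b2; clear; lia.
    - by move=> j; rewrite h2; move: lt2; clear; lia.
  exists c1, (n1 - 2); apply: Or31; apply: fin; move: n2_2 a1 b1 a2 b2 le_c lt_d; clear; lia.
have [lt_c|ge_c] := ltnP c2 c1.
  have n1_2 : n1 <= 2.
    rewrite leqNgt; apply/negP => lt2.
    apply: (@two_rows_left S r c1.-1 uS mS).
    - split; rewrite h1; move: lt2 lt_c; clear; lia.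
    - rewrite h2; move: lt2 lt_c a1 b1 a2 b2; clear; lia.
    - rewrite h2; move: lt2 lt_c a1 b1 a2 b2; clear; lia.
    - by move=> j; rewrite h1; move: lt_c; clear; lia.
  exists c2, (c1 - c2); apply: Or32; apply: fin; move: n1_2 a1 b1 a2 b2 lt_c le_d ge_d; clear; lia.
have e_c : c1 = c2 by move: le_c ge_c; clear; lia.
have e_n : n1 = n2 by move: le_d ge_d e_c; clear; lia.
have n1_2 : n1 < 5.
  rewrite ltnNge; apply/negP => lt5; apply: (@two_rows_long S r c1 uS mS).
  - split; rewrite h2; move: lt5 e_c e_n; clear; lia.
  - split; rewrite h1; move: lt5 e_c e_n; clear; lia.
have [le2|lt2] := leqP n1 2.
  exists c1, 0; apply: Or31; apply: fin; move: le2 e_c e_n a1 b1; clear; lia.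
exists c1, n1; apply: Or33; split; last by rewrite lt2.
by apply: fin.
Qed.

(** * Patterns of two-row shapes *)

Lemma rc_perm k l S S' : perm_eq S S' -> rc k l S = rc k l S'.
Proof.
move=> pS; rewrite /rc (permP pS); apply: eq_count => x /=.
by rewrite (perm_mem pS).
Qed.

Lemma occurs_perm S S' p : perm_eq S S' -> occurs S p -> occurs S' p.
Proof.
move=> pS [w /andP[pw lw] <-]; exists w => //.
by rewrite /linext lw (perm_trans pw pS).
Qed.

Lemma rc_gt0 k l (S : seq cell) i j : (i + k, j + l) \in S -> (i, j) \in S -> 0 < rc k l S.
Proof.
move=> h1 h2; rewrite /rc -has_count; apply/hasP; exists (i + k, j + l) => //=.
by rewrite !leq_addl !addnK.
Qed.

Lemma rc_gt0E k l (S : seq cell) : 0 < rc k l S ->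
  exists i j, (i + k, j + l) \in S /\ (i, j) \in S.
Proof.
rewrite /rc -has_count => /hasP[[i j] ijS /= /and3P[h1 h2 h3]].
by exists (i - k), (j - l); rewrite !subnK.
Qed.

Definition rotate (N x : cell) : cell := (N.1 - x.1, N.2 - x.2).

(** Rotation by 180 degrees reverses the order, hence words are read backwards; a descent traversed
    backwards in the rotated shape is again a descent. *)
Lemma occurs_rot (N : cell) S p : all (fun x => ble x N) S ->
  occurs S p -> occurs (map (rotate N) S) (rev p).
Proof.
move=> bS [w /andP[pw lw] <-]; exists (rev (map (rotate N) w)).
  rewrite /linext perm_rev perm_map //= /linear pairwise_rev pairwise_map.
  apply: (sub_in_pairwise (P := mem S)) lw; last by apply/allP => x; rewrite (perm_mem pw).
  move=> x y /(allP bS) + /(allP bS); rewrite /ble /rotate.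
  by case: x y N {bS} => [? ?] [? ?] [? ?] /=; clear; lia.
have : all (fun x => ble x N) w by apply/allP => x; rewrite (perm_mem pw) => /(allP bS).
elim: w {pw lw} => [|x [|y w] IHw] // /andP[bx bw]; have {}IHw := IHw bw.
rewrite (_ : pat [:: x, y & w] = below x y :: pat (y :: w)) // map_cons !(rev_cons (rotate N x)).
rewrite /pat steps_rcons; last by rewrite /= rev_cons; case: (rev _).
rewrite -[steps _ _]/(pat _) IHw (rev_cons (below x y)); congr (rcons _ _).
case/andP: bw => by_ _; rewrite /= rev_cons last_rcons.
move: bx by_; rewrite /ble /below /rotate; case: x y N {bS IHw} => [? ?] [? ?] [? ?] /=.
by clear; lia.
Qed.

Lemma occurs_map (f : cell -> cell) S p :
  {in S &, forall x y, ble (f x) (f y) = ble x y} ->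
  {in S &, forall x y, below (f x) (f y) = below x y} ->
  occurs S p -> occurs (map f S) p.
Proof.
move=> fb fr [w /andP[pw lw] <-].
have wS : all (mem S) w by apply/allP => x; rewrite (perm_mem pw).
exists (map f w).
  rewrite /linext perm_map //= /linear pairwise_map.
  by apply: (sub_in_pairwise (P := mem S)) wS lw => x y xS yS /=; rewrite fb.
case: w wS {pw lw} => //= x w; elim: w x => //= y w IHw x /and3P[xS yS wS].
by rewrite fr // IHw //= yS.
Qed.

(** The patterns of the shapes (m,2): a descent occurs on entering the lower row. In the second form
    both lower boxes are read in succession, so two upper boxes precede them and [0 < i]. *)
Definition two_letter_pattern (p : seq bool) : Prop :=
  (exists i j k, 0 < j /\ p = nseq i false ++ true :: nseq j false ++ true :: nseq k false)
  \/ (exists i j, [/\ 0 < i, 0 < j & p = nseq i false ++ true :: nseq j false]).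

Lemma two_letter_rev p : two_letter_pattern p -> two_letter_pattern (rev p).
Proof.
have rn n (b : bool) : rev (nseq n b) = nseq n b.
  by elim: n => //= n IHn; rewrite rev_cons IHn -nseq_rcons.
case=> [[i [j [k [j0 ->]]]]|[i [j [i0 j0 ->]]]].
  by left; exists k, j, i; rewrite !(rev_cat, rev_cons) !rn -!cats1 -!catA.
by right; exists j, i; rewrite !(rev_cat, rev_cons) !rn -!cats1 -!catA.
Qed.

Lemma steps_row r (x : cell) s : all (fun x => x.1 == r) (x :: s) ->
  steps below (x :: s) = nseq (size s) false.
Proof.
elim: s x => // y s IHs x /= /and3P[/eqP xr yr sr]; rewrite /below xr (eqP yr) ltnn.
by congr (_ :: _); apply: IHs; rewrite /= yr.
Qed.

Lemma two_letter_pat r (w1 w2 w3 : seq cell) (L1 L2 : cell) :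
  all (fun x => x.1 == r) w1 -> all (fun x => x.1 == r) w2 ->
  all (fun x => x.1 == r) w3 -> L1.1 = r.+1 -> L2.1 = r.+1 -> 0 < size w1 ->
  pat (w1 ++ L1 :: w2 ++ L2 :: w3) = nseq (size w1).-1 false ++ true ::
    (if nilp w2 then false :: nseq (size w3) false
     else nseq (size w2) false ++ true :: nseq (size w3) false).
Proof.
move=> h1 h2 h3 e1 e2 w1_gt0.
have tail s L : all (fun x => x.1 == r) s -> L.1 = r.+1 ->
    steps below (L :: s) = nseq (size s) false.
  case: s => // x s hs eL; rewrite /= -(steps_row hs) /= /below eL.
  by case/andP: hs => /eqP-> _; rewrite ltnNge leqnSn.
have body s L : all (fun x => x.1 == r) s -> L.1 = r.+1 -> 0 < size s ->
    steps below (rcons s L) = rcons (steps below s) true.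
  case/lastP: s => // s x hs eL _; rewrite steps_rcons; last by case: (s).
  by rewrite last_rcons /below eL; move: hs; rewrite all_rcons => /andP[/eqP-> _]; rewrite ltnSn.
rewrite /pat steps_cat body // -cats1 -catA; congr (_ ++ _).
  by case: w1 h1 {w1_gt0} => // x s; exact: steps_row.
congr (_ :: _); case: w2 h2 => [_|x s hs].
  by rewrite /= -[pairmap _ _ _]/(steps below (L2 :: w3)) tail // /below e1 e2 ltnn.
rewrite -[L1 :: _]/((L1 :: x :: s) ++ L2 :: w3) steps_cat (tail w3 L2) //.
rewrite -[rcons (L1 :: _) _]/(L1 :: rcons (x :: s) L2).
have -> : steps below (L1 :: rcons (x :: s) L2) = false :: steps below (rcons (x :: s) L2).
  rewrite /= /below e1; case/andP: (hs) => /eqP-> _.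
  by rewrite ltnNge leqnSn.
by rewrite body // (steps_row hs) /= -cats1 -catA.
Qed.

Lemma short_row_below_occurs r c m p : occurs (two_rows r c m.+2 c 2) p <->
  two_letter_pattern p /\ size p = m.+3.
Proof.
split=> [[w /andP[pw lw] <-]|].
  have szw : size w = m.+4.
    by rewrite (perm_size pw) size_cat !size_map !size_iota addn2.
  split; last by rewrite size_pat szw.
  have mw i j : (i, j) \in w = (i == r) && (c <= j < c + m.+2) || (i == r.+1) && (c <= j < c + 2).
    by rewrite (perm_mem pw) mem_two_rows.
  pose L1 : cell := (r.+1, c); pose L2 : cell := (r.+1, c.+1).
  have L1w : L1 \in w by rewrite mw; clear; lia.
  have L2w : L2 \in w by rewrite mw; clear; lia.
  have uw := linear_uniq lw.
  case/splitPr: L1w => w1 t in pw lw szw mw L2w uw *.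
  move: lw; rewrite linear_cat /= => /and3P[/allrelP l1 _ /andP[/allP l2 lt]].
  have L2t : L2 \in t.
    move: L2w; rewrite mem_cat inE => /or3P[L2w1||//].
      have := l1 L2 L1 L2w1 (mem_head _ _).
      by rewrite /ble /= leqnn leqnSn.
    by rewrite xpair_eqE; clear; lia.
  case/splitPr: L2t => w2 w3 in pw szw mw L2w uw l1 l2 lt *.
  move: lt; rewrite linear_cat /= => /and3P[_ _ /andP[/allP l3 _]].
  have row x : x \in w1 ++ L1 :: w2 ++ L2 :: w3 -> x \in w1 ++ w2 ++ w3 -> x.1 == r.
    case: x => i j; rewrite mw => /orP[/andP[-> _]//|/andP[/eqP-> hj]].
    have {hj} : (r.+1, j) = L1 \/ (r.+1, j) = L2.
      have [->|ne] := eqVneq j c; first by left.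
      by right; congr (_, _); move: ne hj; clear; lia.
    move: uw; rewrite (perm_uniq (s2 := L1 :: L2 :: w1 ++ w2 ++ w3)); last first.
      apply/permP => P; rewrite /= !count_cat /= !count_cat /=.
      by move: (count P w1) (count P w2) (count P w3) (P L1 : nat) (P L2 : nat); clear; lia.
    by rewrite /= inE negb_or => /and3P[/andP[_ n1] n2 _] [->|->] h; rewrite h in n1 n2.
  have sub s : {subset s <= w1 ++ w2 ++ w3} -> all (fun x => x.1 == r) s.
    move=> hs; apply/allP => x /hs xs; apply: row => //.
    by move: xs; rewrite !(mem_cat, inE) => /or3P[] ->; rewrite ?orbT.
  have r1 := sub w1; have r2 := sub w2; have r3 := sub w3.
  have U1 : (r, c) \in w1.
    have := mw r c; rewrite !(mem_cat, inE).
    have -> : (r == r) && (c <= c < c + m.+2) || (r == r.+1) && (c <= c < c + 2) by clear; lia.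
    rewrite !xpair_eqE (ltn_eqF (ltnSn r)) /=.
    case/or3P => // h; first have := l2 (r, c); last have := l2 (r, c).
      by rewrite mem_cat h => /(_ isT); rewrite /ble /= leqnn leqnSn.
    by rewrite mem_cat inE h !orbT => /(_ isT); rewrite /ble /= leqnn leqnSn.
  have U2 : (r, c.+1) \in w1 ++ w2.
    have := mw r c.+1; rewrite !(mem_cat, inE).
    have -> : (r == r) && (c <= c.+1 < c + m.+2) || (r == r.+1) && (c <= c.+1 < c + 2) by clear; lia.
    rewrite !xpair_eqE (ltn_eqF (ltnSn r)) /= => /or3P[->//|->|h]; first by rewrite orbT.
    by have := l3 (r, c.+1) h; rewrite /ble /= leqnn leqnSn.
  have w1_gt0 : 0 < size w1 by case: (w1) U1.
  rewrite (two_letter_pat (r := r)) //; first last.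
  - by apply: r3 => x xs; rewrite !mem_cat xs !orbT.
  - by apply: r2 => x xs; rewrite !mem_cat xs !orbT.
  - by apply: r1 => x xs; rewrite !mem_cat xs.
  case: nilP => [w2_0|w2_0].
    right; exists (size w1).-1, (size w3).+1; split=> //.
    rewrite w2_0 cats0 in U2.
    have : size [:: (r, c); (r, c.+1)] <= size w1.
      apply: uniq_leq_size; first by rewrite /= inE xpair_eqE; clear; lia.
      by move=> x; rewrite !inE => /orP[]/eqP->.
    by rewrite /=; clear; lia.
  left; exists (size w1).-1, (size w2), (size w3); split=> //.
  by case: (w2) w2_0.
case=> tp szp.
pose U a b := [seq (r, t) | t <- iota a b] : seq cell.
have sU a b : size (U a b) = b by rewrite size_map size_iota.
have rU a b : all (fun x => x.1 == r) (U a b) by apply/allP => _ /mapP[t _ ->] /=.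
have mU a b x : x \in U a b -> exists2 t, a <= t < a + b & x = (r, t).
  by case/mapP=> t; rewrite mem_iota => ht ->; exists t.
have key a b d : 0 < a -> 1 < a + b -> a + b + d = m.+2 ->
    linext (two_rows r c m.+2 c 2)
      (U c a ++ (r.+1, c) :: U (c + a) b ++ (r.+1, c.+1) :: U (c + a + b) d).
  move=> a0 ab abd; apply/andP; split.
    rewrite /two_rows -abd !iotaD !map_cat -/(U _ _) -/(U _ _) -/(U _ _) addnA.
    apply/permP => P; rewrite /= !count_cat /= !count_cat /= addn0.
    move: (P (r.+1, c) : nat) (P (r.+1, c.+1) : nat).
    by move: (count P _) (count P _) (count P _); clear; lia.
  have lU a' b' : linear (U a' b').
    rewrite /linear pairwise_map; have := iota_ltn_sorted a' b'.
    rewrite sorted_pairwise; last exact: ltn_trans.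
    by apply: sub_pairwise => x y; rewrite /ble /= leqnn -ltnNge.
  rewrite linear_cat /= lU linear_cat /= !lU /= !andbT.
  apply/and4P; split.
  - apply/allrelP => _ y /mU[t ht ->]; rewrite inE mem_cat inE.
    case/or4P=> [/eqP->|/mU[t' ht' ->]|/eqP->|/mU[t' ht' ->]]; rewrite /ble /=; move: ht; try move: ht'; clear; lia.
  - apply/allP => y; rewrite mem_cat inE.
    case/or3P=> [/mU[t' ht' ->]|/eqP->|/mU[t' ht' ->]]; rewrite /ble /=; move: a0; try move: ht'; clear; lia.
  - apply/allrelP => _ y /mU[t ht ->]; rewrite inE.
    case/orP=> [/eqP->|/mU[t' ht' ->]]; rewrite /ble /=; move: ht; try move: ht'; clear; lia.
  - by apply/allP => _ /mU[t ht ->]; rewrite /ble /=; move: ht ab; clear; lia.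
case: tp szp => [[i [j [k [j0 ->]]]]|[i [j [i0 j0 ->]]]].
  rewrite !(size_cat, size_nseq) /= !(size_cat, size_nseq) /= size_nseq => sz.
  exists (U c i.+1 ++ (r.+1, c) :: U (c + i.+1) j ++ (r.+1, c.+1) :: U (c + i.+1 + j) k).
    by apply: key => //; move: sz j0; clear; lia.
  by rewrite (two_letter_pat (r := r)) ?rU // /nilp !sU //; case: j j0 sz.
rewrite size_cat size_nseq /= size_nseq => sz.
(* The step between the two lower boxes is itself an ascent, which leaves [j.-1] upper boxes for the
   end. *)
exists (U c i.+1 ++ (r.+1, c) :: U (c + i.+1) 0 ++ (r.+1, c.+1) :: U (c + i.+1 + 0) j.-1).
  by apply: key => //; move: sz i0 j0; clear; lia.
by rewrite (two_letter_pat (r := r)) ?rU // /nilp !sU //; case: j j0 sz.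
Qed.

Lemma size_two_rows r c1 n1 c2 n2 : size (two_rows r c1 n1 c2 n2) = n1 + n2.
Proof. by rewrite size_cat !size_map !size_iota. Qed.

Lemma short_row_above_occurs r c m p : occurs (two_rows r (c + m) 2 c m.+2) p <->
  two_letter_pattern p /\ size p = m.+3.
Proof.
(* The sum of first and last row and of first and last column, so that the rotation keeps the
   bounding rectangle in place. *)
pose N : cell := (r + r.+1, c + c + m.+1).
have p1 : perm_eq (map (rotate N) (two_rows r (c + m) 2 c m.+2)) (two_rows r c m.+2 c 2).
  apply: uniq_perm; rewrite ?uniq_two_rows //.
    rewrite map_inj_in_uniq ?uniq_two_rows // => -[i j] [i' j'].
    by rewrite !mem_two_rows /rotate /N /= => h h' [? ?]; congr (_, _); lia.
  move=> [i j]; rewrite mem_two_rows; apply/mapP/idP => [[[i' j']]|h].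
    by rewrite mem_two_rows /rotate /N /= => h [-> ->]; lia.
  exists (rotate N (i, j)); rewrite ?mem_two_rows /rotate /N /=; first by lia.
  by congr (_, _); lia.
have p2 : perm_eq (map (rotate N) (two_rows r c m.+2 c 2)) (two_rows r (c + m) 2 c m.+2).
  apply: uniq_perm; rewrite ?uniq_two_rows //.
    rewrite map_inj_in_uniq ?uniq_two_rows // => -[i j] [i' j'].
    by rewrite !mem_two_rows /rotate /N /= => h h' [? ?]; congr (_, _); lia.
  move=> [i j]; rewrite mem_two_rows; apply/mapP/idP => [[[i' j']]|h].
    by rewrite mem_two_rows /rotate /N /= => h [-> ->]; lia.
  exists (rotate N (i, j)); rewrite ?mem_two_rows /rotate /N /=; first by lia.
  by congr (_, _); lia.
split=> [op|[hp szp]].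
  have /(occurs_perm p1) : occurs (map (rotate N) (two_rows r (c + m) 2 c m.+2)) (rev p).
    apply: occurs_rot => //; apply/allP => -[i j].
    by rewrite mem_two_rows /ble /N /=; lia.
  by case/short_row_below_occurs => /two_letter_rev; rewrite revK size_rev.
apply: (occurs_perm p2); rewrite -(revK p); apply: occurs_rot.
  by apply/allP => -[i j]; rewrite mem_two_rows /ble /N /=; lia.
by apply/short_row_below_occurs; rewrite size_rev; split=> //; exact: two_letter_rev.
Qed.

(** For n boxes, a row of n - 2 boxes exists in (m,2) and its rotation but not in two equal rows of
    at least three boxes, where a 2 x 3 rectangle exists instead. So [rc 0 (n - 3)] and [rc 1 2]
    force [A] and [B] to be of the same kind, and then the size settles which patterns occur. *)
Lemma two_rows_occurs (A B : seq cell) rA kA rB kB p :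
  convex A -> uniq A -> mfree A -> square A rA kA ->
  (forall x, x \in A -> rA <= x.1 <= rA.+1) ->
  convex B -> uniq B -> mfree B -> square B rB kB ->
  (forall x, x \in B -> rB <= x.1 <= rB.+1) ->
  size A = size B -> (forall k l, rc k l A <= rc k l B) ->
  occurs B p -> occurs A p.
Proof.
move=> cA uA mA sA hA cB uB mB sB hB szAB le_rc.
have hclass S r k : convex S -> uniq S -> mfree S -> square S r k ->
    (forall x, x \in S -> r <= x.1 <= r.+1) ->
    [/\ forall q, occurs S q <-> two_letter_pattern q /\ (size q).+1 = size S,
        3 < size S, 0 < rc 0 (size S - 3) S & rc 1 2 S = 0]
    \/ exists c m, perm_eq S (two_rows r c m c m) /\ 2 < m.
  move=> cS uS mS sq hS; have [c [m h]] := two_rows_class cS uS mS sq hS.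
  have eq12 T q : perm_eq S T -> occurs S q <-> occurs T q.
    by move=> pT; split; apply: occurs_perm; rewrite // perm_sym.
  case: h => [pS|pS|[pS /andP[m3 _]]]; [left|left|right].
  - have szS : size S = m.+4 by rewrite (perm_size pS) size_two_rows addn2.
    split; rewrite ?szS // ?(rc_perm _ _ pS).
    + by move=> q; rewrite (eq12 _ _ pS) short_row_below_occurs; split=> -[h1 h2]; split=> //; move: h2; clear; lia.
    + by apply: (@rc_gt0 _ _ _ r c); rewrite mem_two_rows; clear; lia.
    + apply/eqP; rewrite -leqn0 leqNgt; apply/negP => /rc_gt0E[i [j []]].
      by rewrite !mem_two_rows; clear; lia.
  - have szS : size S = m.+4 by rewrite (perm_size pS) size_two_rows.
    split; rewrite ?szS // ?(rc_perm _ _ pS).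
    + by move=> q; rewrite (eq12 _ _ pS) short_row_above_occurs; split=> -[h1 h2]; split=> //; move: h2; clear; lia.
    + by apply: (@rc_gt0 _ _ _ r.+1 c); rewrite mem_two_rows; clear; lia.
    + apply/eqP; rewrite -leqn0 leqNgt; apply/negP => /rc_gt0E[i [j []]].
      by rewrite !mem_two_rows; clear; lia.
  - by exists c, m.
case: (hclass _ _ _ cA uA mA sA hA) => [[occA szA rcA _]|[cA' [m [pA m3]]]];
  case: (hclass _ _ _ cB uB mB sB hB) => [[occB szB _ rcB]|[cB' [m' [pB m3']]]].
- by rewrite occA occB szAB.
- have := leq_trans rcA (le_rc _ _); rewrite (rc_perm _ _ pB) => /rc_gt0E[i [j []]].
  have := perm_size pB; rewrite size_two_rows -szAB !mem_two_rows => ->.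
  by move: m3'; clear; lia.
- have : 0 < rc 1 2 A.
    rewrite (rc_perm _ _ pA).
    by apply: (@rc_gt0 _ _ _ rA cA'); rewrite mem_two_rows; move: m3; clear; lia.
  by move/leq_trans/(_ (le_rc _ _)); rewrite rcB.
have em : m = m'.
  move: szAB; rewrite (perm_size pA) (perm_size pB) !size_two_rows; clear; lia.
pose f (x : cell) : cell := (rA + (x.1 - rB), cA' + (x.2 - cB')).
have inB x : x \in B -> (rB <= x.1) && (cB' <= x.2).
  by rewrite (perm_mem pB); case: x => i j; rewrite mem_two_rows /=; clear; lia.
have pf : perm_eq (map f B) A.
  apply: uniq_perm => //.
    rewrite map_inj_in_uniq // => -[i j] [i' j'] /inB + /inB; rewrite /f /=.
    by move=> h h' [? ?]; congr (_, _); move: h h'; lia.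
  move=> [i j]; rewrite (perm_mem pA) mem_two_rows; apply/mapP/idP => [[[i' j']]|h].
    by rewrite (perm_mem pB) mem_two_rows /f /= => + [-> ->]; move: em; clear; lia.
  exists (rB + (i - rA), cB' + (j - cA')).
    by rewrite (perm_mem pB) mem_two_rows; move: em h; clear; lia.
  by rewrite /f /=; congr (_, _); move: h; clear; lia.
move=> /(@occurs_map f); move=> h; apply: (occurs_perm pf); apply: h.
  by move=> x y /inB + /inB; rewrite /ble /f /=; case: x y => [? ?] [? ?] /=; clear; lia.
by move=> x y /inB + /inB; rewrite /below /f /=; case: x y => [? ?] [? ?] /=; clear; lia.
Qed.

(** * Comparison of supports *)

Lemma row_starts (S : seq cell) : convex S -> uniq S ->
  exists2 L : seq cell, uniq (map fst L) & rc 0 1 S + size L = size S /\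
    map fst L =i map fst S.
Proof.
move=> cS uS; pose a (b : cell) := [&& 0 <= b.1, 1 <= b.2 & (b.1 - 0, b.2 - 1) \in S].
exists (filter (predC a) S); last split.
- rewrite map_inj_in_uniq ?filter_uniq // => -[i j] [i' j'].
  rewrite !mem_filter => /andP[na ijS] /andP[na' ijS'] /= ei; move: ijS' na'; rewrite -{i'}ei.
  have le u v : (i, u) \in S -> (i, v) \in S -> ~~ a (i, v) -> v <= u.
    move=> uS' vS; rewrite leqNgt; apply: contra => uv; rewrite /a /= subn0.
    by rewrite (leq_trans _ uv) //=; apply: cS uS' vS _ _; rewrite /ble /=; move: uv; clear; lia.
  move=> ijS' na'; congr (_, _); apply/eqP; rewrite eqn_leq.
  by rewrite (le j' j) // (le j j').
- by rewrite /rc size_filter count_predC.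
move=> i; apply/mapP/mapP => [[x]|[[i0 j] ijS -> {i}]].
  by rewrite mem_filter => /andP[_ xS] ->; exists x.
have ex : exists t, (i0, t) \in S by exists j.
case: (ex_minnP ex) => t tS ht; exists (i0, t) => //.
rewrite mem_filter tS andbT /a /= subn0; apply/negP => /andP[t0 /ht].
by move: t0; clear; lia.
Qed.

(** By [row_starts], the size minus [rc 0 1] is the number of nonempty rows. So [B] has at most two
    of them, and its square occupies both. *)
Lemma two_rows_inherit (A B : seq cell) rA rB kB :
  convex A -> uniq A -> (forall x, x \in A -> rA <= x.1 <= rA.+1) ->
  convex B -> uniq B -> square B rB kB ->
  size A = size B -> rc 0 1 A <= rc 0 1 B ->
  forall x, x \in B -> rB <= x.1 <= rB.+1.
Proof.
move=> cA uA hA cB uB [aB _ bB _] szAB le_rc x xB.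
have [LA uLA [szA mA]] := row_starts cA uA; have [LB uLB [szB mB]] := row_starts cB uB.
have szLA : size LA <= 2.
  rewrite -(size_map fst) -[2]/(size [:: rA; rA.+1]); apply: uniq_leq_size => // i.
  by rewrite mA => /mapP[[y1 y2] /hA + ->]; rewrite !inE /=; clear; lia.
have szLB : size LB <= 2 by rewrite -(leq_add2l (rc 0 1 B)) szB -szAB -szA leq_add.
have [//|out] := boolP (rB <= x.1 <= rB.+1).
suff : 2 < size LB by rewrite ltnNge szLB.
rewrite -(size_map fst) -[3]/(size [:: rB; rB.+1; x.1]); apply: uniq_leq_size.
  by rewrite /= !inE; move: out; case: (x) => [x1 x2] /=; clear; lia.
move=> i; rewrite mB !inE => /or3P[]/eqP->; apply/mapP.
- by exists (rB, kB).
- by exists (rB.+1, kB).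
- by exists x.
Qed.

Lemma rows_occurs (A B : seq cell) rA kA p :
  convex A -> uniq A -> mfree A -> square A rA kA ->
  (forall x, x \in A -> rA <= x.1 <= rA.+1) ->
  convex B -> uniq B -> mfree B ->
  size A = size B -> (forall k l, rc k l A <= rc k l B) ->
  occurs B p -> occurs A p.
Proof.
move=> cA uA mA sA hA cB uB mB szAB le_rc.
have : 0 < rc 1 1 B.
  apply: leq_trans (le_rc 1 1); case: sA => h _ _ h'.
  by apply: (@rc_gt0 _ _ _ rA kA); rewrite ?addn1.
case/rc_gt0E => i [j []]; rewrite !addn1 => h' h.
have sB : square B i j.
  by split=> //; apply: cB h h' _ _; rewrite /ble /= ?leqnn ?leqnSn.
apply: (two_rows_occurs cA uA mA sA hA cB uB mB sB _ szAB le_rc).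
exact: two_rows_inherit cA uA hA cB uB sB szAB (le_rc _ _).
Qed.

Lemma square_swap S r k : square S r k -> square (map swap S) k r.
Proof. by case=> h1 h2 h3 h4; split; rewrite mem_swap. Qed.

(** For thin [A] the shape of [B] does not matter: its word shows that [p] obeys the bounds of [B],
    hence those of [A]. Otherwise [A] has a square, and so does [B] because of [rc 1 1]. *)
Theorem occurs_sub (A B : seq cell) p :
  convex A -> uniq A -> mfree A -> convex B -> uniq B -> mfree B ->
  size A = size B -> (forall k l, rc k l A <= rc k l B) ->
  occurs B p -> occurs A p.
Proof.
move=> cA uA mA cB uB mB szAB le_rc opB.
have [tA|[r [k sA]]] := thin_or_square cA.
  case: opB => w lw <-; apply: thin_occurs => //.
    by have /andP[/perm_size sw _] := lw; rewrite size_pat sw szAB.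
  by move=> k l; rewrite szAB; apply: leq_trans (le_rc k l) (rc_le_prefixes k l cB lw).
have [hA|hA] := two_rows_or_columns cA uA mA sA.
  exact: rows_occurs cA uA mA sA hA cB uB mB szAB le_rc opB.
have uS S : uniq S -> uniq (map swap S) by move=> uS; rewrite map_inj_uniq //; exact: swap_inj.
suff /(occurs_swap (convex_swap cA)) : occurs (map swap A) (map negb p).
  by rewrite map_swapK (mapK negbK).
apply: (@rows_occurs _ (map swap B) k r _ _ _ _ _ _ _ _ _ _ _ (occurs_swap cB opB)); rewrite ?size_map //.
- exact: convex_swap.
- exact: uS.
- exact: mfree_swap.
- exact: square_swap.
- by move=> x; rewrite mem_swap => /hA.
- exact: convex_swap.
- exact: uS.
- exact: mfree_swap.
- by move=> k' l'; rewrite !rc_swap.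
Qed.

(** Take a word of [B] attaining the bound; its pattern occurs in [A] too and obeys the bound
    there. *)
Theorem occurs_rc (A B : seq cell) : convex A -> convex B -> uniq B ->
  size A = size B -> (forall p, occurs B p -> occurs A p) ->
  forall k l, rc k l A <= rc k l B.
Proof.
move=> cA cB uB szAB h k l.
have [w lw hw] := prefixes_attained k l cB uB.
have [w' lw' eqp] := h _ (ex_intro2 _ _ w lw erefl).
by apply: leq_trans (rc_le_prefixes k l cA lw') _; rewrite eqp szAB.
Qed.

(** * Rows and dominance *)

Lemma partition_nth (s : seq nat) i j : is_partition s -> i <= j -> nth 0 s j <= nth 0 s i.
Proof.
case/andP=> _ ss le_ij; have [lt_j|le_j] := ltnP j (size s); last by rewrite nth_default.
have tr : transitive geq by move=> y x z /= h1 h2; exact: leq_trans h2 h1.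
by apply: (sorted_leq_nth tr leqnn 0 ss) => //; exact: leq_ltn_trans le_ij lt_j.
Qed.

Lemma sumn_all0 (s : seq nat) : all (pred1 0) s -> sumn s = 0.
Proof. by elim: s => //= x s IHs /andP[/eqP-> /IHs]. Qed.

Section Shape.

Variables (n : nat) (A : skew_shape n).
Local Notation lam := (nth 0 (outer A)).
Local Notation mu := (nth 0 (inner A)).

Lemma lam_mono i j : i <= j -> lam j <= lam i.
Proof. exact/partition_nth/outer_partition. Qed.

Lemma mu_mono i j : i <= j -> mu j <= mu i.
Proof. exact/partition_nth/inner_partition. Qed.

Lemma mem_boxes i j : ((i, j) \in boxes A) = (mu i <= j < lam i).
Proof.
have sub := inner_sub_outer A i.
apply/allpairsPdep/idP => [[i' [j' []]]|/andP[le_j lt_j]].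
  by rewrite !mem_iota => _ + [-> ->]; rewrite subnKC // inner_sub_outer.
exists i, j; split; rewrite // mem_iota; last by rewrite subnKC // le_j.
by rewrite /= ltnNge; apply/negP => le_i; rewrite nth_default in lt_j.
Qed.

Lemma boxes_uniq : uniq (boxes A).
Proof.
apply: allpairs_uniq_dep => [|i _|]; rewrite ?iota_uniq //.
by move=> [i j] [i' j'] _ _ /= [-> ->].
Qed.

Lemma boxes_convex : convex (boxes A).
Proof.
move=> [a b] [c d] [i j]; rewrite !mem_boxes /ble /= => /andP[h1 h2] /andP[h3 h4].
move=> /andP[ai bj] /andP[ic jd]; apply/andP; split.
  by apply: leq_trans bj; apply: leq_trans h1; exact: mu_mono.
by apply: leq_ltn_trans jd _; apply: leq_trans h4 _; exact: lam_mono.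
Qed.

Lemma size_boxes : size (boxes A) = n. Proof. exact: size_skew. Qed.

Lemma count_iota_interval a b N :
  count (fun j => a <= j < b) (iota 0 N) = minn b N - a.
Proof.
elim: N => [|N IHN]; first by rewrite minn0.
by rewrite -addn1 iotaD count_cat IHN /= add0n; clear; lia.
Qed.

Lemma count_iota_geq a m d : m <= a -> count (leq a) (iota m d) = m + d - a.
Proof.
move=> le_ma; elim: d => [|d IHd]; first by rewrite /=; move: le_ma; clear; lia.
by rewrite -addn1 iotaD count_cat IHd /=; move: le_ma; clear; lia.
Qed.

Lemma overlapE k i : overlap A k.+1 i = lam (i + k) - mu i.
Proof.
rewrite /overlap -(minn_idPl (lam_mono (leq0n (i + k)))).
rewrite -count_iota_interval; apply: eq_count => j.
apply/allP/andP => [h|[h1 h2] i'].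
  have := h (i + k); rewrite mem_iota mem_boxes leq_addr addnS ltnSn => /(_ isT)/andP[_ ->].
  by have := h i; rewrite mem_iota mem_boxes leqnn addnS ltnS leq_addr => /(_ isT)/andP[->].
rewrite mem_iota mem_boxes addnS ltnS => /andP[le_i le_i'].
by rewrite (leq_trans (mu_mono le_i)) // (leq_trans h2) // lam_mono.
Qed.

(** A box of row [i + k] is a lower right corner when it lies at least [l] columns right of the
    start of row [i], which leaves overlap minus [l] choices. The zero overlaps dropped by [rows]
    contribute nothing. *)
Lemma rc_rows k l : rc k l (boxes A) = sumn [seq x - l | x <- rows A k.+1].
Proof.
have -> : sumn [seq x - l | x <- rows A k.+1] =
    sumn [seq lam (i + k) - mu i - l | i <- iota 0 (size (outer A) - k)].
  rewrite (perm_sumn (perm_map _ (permEl (perm_sort _ _)))) subSS.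
  transitivity (sumn [seq x - l | x <- [seq overlap A k.+1 i | i <- iota 0 (size (outer A) - k)]]).
    by elim: [seq overlap _ _ _ | _ <- _] => //= -[|x] s IHs /=; rewrite IHs.
  by rewrite -map_comp; congr sumn; apply: eq_map => i /=; rewrite overlapE.
rewrite {1}/rc {2}/boxes /skew_boxes count_flatten -map_comp.
have hrow i : i \in iota 0 (size (outer A)) ->
    count (fun b : cell => [&& k <= b.1, l <= b.2 & (b.1 - k, b.2 - l) \in boxes A])
      [seq (i, j) | j <- iota (mu i) (lam i - mu i)]
    = if k <= i then lam i - mu (i - k) - l else 0.
  move=> _; rewrite count_map; case: leqP => [le_k|lt_k]; last first.
    rewrite (eq_count (a2 := pred0)) ?count_pred0 // => j.
    by rewrite /= leqNgt lt_k.
  have hmu := mu_mono (leq_subr k i); have hlam := lam_mono (leq_subr k i).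
  have sub := inner_sub_outer A i.
  rewrite (eq_in_count (a2 := leq (mu (i - k) + l))).
    by rewrite count_iota_geq ?subnKC ?subnDA // (leq_trans hmu) ?leq_addr.
  move=> j; rewrite mem_iota subnKC // => /andP[h1 h2] /=; rewrite le_k mem_boxes /=.
  by move: hmu hlam h1 h2; clear; lia.
transitivity (sumn [seq (if k <= i then lam i - mu (i - k) - l else 0)
                       | i <- iota 0 (size (outer A))]).
  by congr sumn; apply/eq_in_map => i /hrow.
have [le_k|lt_k] := leqP k (size (outer A)); last first.
  rewrite (eqP (ltnW lt_k : _ - _ == 0)) /=.
  apply: sumn_all0; apply/allP => _ /mapP[i + ->]; rewrite mem_iota => /andP[_ lt_i].
  by rewrite leqNgt (ltn_trans lt_i).
rewrite -{1}(subnKC le_k) iotaD map_cat sumn_cat.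
have -> : sumn [seq (if k <= i then lam i - mu (i - k) - l else 0) | i <- iota 0 k] = 0.
  apply: sumn_all0; apply/allP => _ /mapP[i + ->]; rewrite mem_iota => /andP[_ lt_i].
  by rewrite leqNgt lt_i.
rewrite add0n -[X in iota X _]addn0 iotaDl -map_comp; congr sumn; apply: eq_map => i /=.
by rewrite leq_addr addKn addnC.
Qed.

End Shape.

Lemma rows_sorted n (A : skew_shape n) k : sorted geq (rows A k).
Proof. by apply: sort_sorted => x y; exact: leq_total. Qed.

Lemma sumn_take_le (s : seq nat) j l :
  sumn (take j s) <= sumn [seq x - l | x <- s] + j * l.
Proof.
elim: s j => [|x s IHs] [|j] //=; have := IHs j; rewrite mulSn.
move: (sumn (take j s)) (sumn [seq y - l | y <- s]) (j * l); clear; lia.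
Qed.

(** The case of equality in [sumn_take_le]. Beyond the end of [s] the term [j * l] is harmless only
    for [l] equal to 0. *)
Lemma sumn_take_threshold (s : seq nat) j l :
  all (leq l) (take j s) -> all (geq l) (drop j s) -> (j <= size s) || (l == 0) ->
  sumn [seq x - l | x <- s] + j * l = sumn (take j s).
Proof.
move=> h1 h2 h3; rewrite -{1}(cat_take_drop j s) map_cat sumn_cat.
have -> : sumn [seq x - l | x <- drop j s] = 0.
  apply: sumn_all0; apply/allP => _ /mapP[x /(allP h2) /= + ->].
  by rewrite -subn_eq0.
have -> : j * l = size (take j s) * l.
  by case/orP: h3 => [/size_takel->//|/eqP->]; rewrite !muln0.
rewrite addn0; elim: (take j s) h1 => //= x t IHt /andP[lx /IHt <-].
by rewrite mulSn addnACA subnK.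
Qed.

Lemma sorted_geq_drop (s : seq nat) j i : sorted geq s ->
  i \in drop j s -> i <= nth 0 s j.
Proof.
move=> ss /(nthP 0)[t]; rewrite size_drop nth_drop => lt_t <-.
have tr : transitive geq by move=> y x z /= h1 h2; exact: leq_trans h2 h1.
have lt_jt : j + t < size s by rewrite -ltn_subRL.
apply: (sorted_leq_nth tr leqnn 0 ss) => //; rewrite ?inE ?leq_addr //.
by rewrite /gtn /= (leq_ltn_trans _ lt_jt) ?leq_addr.
Qed.

(** The sum of the (x - l)^+ is the maximum over [j] of the sum of the first [j] parts minus
    [j * l], and the latter sum is the minimum over [l] of the former plus [j * l]. So each family
    of inequalities implies the other. *)
Lemma dominatedP (a b : seq nat) : sorted geq a -> sorted geq b ->
  dominated a b <-> forall l, sumn [seq x - l | x <- a] <= sumn [seq x - l | x <- b].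
Proof.
move=> sa sb; split=> [dom l|h j /andP[_ le_j]].
  (* The number of parts exceeding [l], where the maximum is attained. *)
  pose j := find (geq l) a.
  have hj : sumn [seq x - l | x <- a] + j * l = sumn (take j a).
    apply: sumn_take_threshold; last by rewrite find_size.
      apply/(all_nthP 0) => i; rewrite size_takel ?find_size // => lt_i.
      rewrite nth_take //; have := before_find 0 lt_i.
      by rewrite /geq /= => /negbT; rewrite -ltnNge => /ltnW.
    apply/allP => i /(sorted_geq_drop sa) /= h; apply: leq_trans h _.
    have [has_l|/hasPn no] := boolP (has (geq l) a); first exact: (nth_find 0 has_l).
    rewrite nth_default // /j hasNfind //; exact/hasPn.
  case: (posnP j) => [j0|j_gt0].
    by move: hj; rewrite j0 take0 addn0 /= => ->.
  rewrite -(leq_add2r (j * l)) hj; apply: leq_trans (sumn_take_le _ _ _).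
  by apply: dom; rewrite j_gt0 find_size.
(* The part following the first [j], where the minimum is attained; it is 0 if [b] has no further
   part. *)
pose l := nth 0 b j.
have <- : sumn [seq x - l | x <- b] + j * l = sumn (take j b).
  apply: sumn_take_threshold.
  - apply/(all_nthP 0) => i; rewrite size_take_min leq_min => /andP[lt_i lt_ib].
    rewrite nth_take // /l; have [lt_j|le_j'] := ltnP j (size b); last by rewrite nth_default.
    apply: sorted_geq_drop sb _; rewrite -(subnKC (ltnW lt_i)) -nth_drop mem_nth //.
    by rewrite size_drop ltn_sub2r // (ltn_trans lt_i).
  - by apply/allP => i /(sorted_geq_drop sb).
  - by case: leqP => //= lt_j; rewrite /l nth_default // ltnW.
by apply: leq_trans (sumn_take_le _ _ l) _; rewrite leq_add2r.
Qed.

Lemma dominated_rc n (A B : skew_shape n) :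
  (forall k, 1 <= k -> dominated (rows A k) (rows B k)) <->
  (forall k l, rc k l (boxes A) <= rc k l (boxes B)).
Proof.
split=> [h k l|h [//|k] _].
  by rewrite !rc_rows; have /dominatedP := h k.+1 isT; apply; exact: rows_sorted.
by apply/dominatedP; [exact: rows_sorted|exact: rows_sorted|move=> l; rewrite -!rc_rows].
Qed.

(** * Tableaux *)

(** Entries count from 1 and bits from 0, so the step from entry [i] to [i.+1] is bit [i.-1]. *)
Definition descents_of (n : nat) (p : seq bool) : {set 'I_n} :=
  [set i : 'I_n | (0 < i) && nth false p i.-1].

Lemma descents_of_inj n p q : size p = n.-1 -> size q = n.-1 ->
  descents_of n p = descents_of n q -> p = q.
Proof.
move=> szp szq /setP e; apply: (@eq_from_nth _ false); rewrite ?szp ?szq // => i lt_i.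
have lt_in : i.+1 < n by case: (n) lt_i.
by have := e (Ordinal lt_in); rewrite !inE.
Qed.

Section Tableaux.

Variables (n : nat) (A : skew_shape n).

Lemma ssval_in (b : box A) : ssval b \in boxes A. Proof. exact: ssvalP. Qed.

Lemma SYT_of_word w : linext (boxes A) w -> exists T : filling A,
  [/\ is_SYT T, descent_set T = descents_of n (pat w) &
      forall b, T b = (index (ssval b) w).+1 :> nat].
Proof.
case/andP=> pw lw; have szw : size w = n by rewrite (perm_size pw) size_boxes.
have inw (b : box A) : ssval b \in w by rewrite (perm_mem pw) ssval_in.
pose T : filling A := [ffun b => inord (index (ssval b) w).+1].
have TE b : T b = (index (ssval b) w).+1 :> nat.
  have lt_b : index (ssval b) w < n by rewrite -[X in _ < X]szw index_mem.
  by rewrite ffunE inordK.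
have uw := linear_uniq lw.
have mono (b b' : box A) : ble (ssval b) (ssval b') -> ssval b != ssval b' -> T b < T b'.
  by move=> h1 h2; rewrite !TE ltnS; exact: linear_index.
exists T; split=> //.
  apply/and4P; split.
  - by apply/forallP => b; rewrite TE.
  - apply/injectiveP => b b' /(congr1 val) /=; rewrite !TE => -[e]; apply: val_inj => /=.
    by rewrite -(nth_index (ssval b) (inw b)) e nth_index.
  - apply/forallP => b; apply/forallP => b'; apply/implyP => /andP[/eqP e lt_c].
    apply: mono; first by rewrite /ble -/(box_row b) e leqnn ltnW.
    by apply: contraTneq lt_c; rewrite /box_col => ->; rewrite ltnn.
  apply/forallP => b; apply/forallP => b'; apply/implyP => /andP[/eqP e lt_c].
  apply: mono; first by rewrite /ble -/(box_col b) e leqnn andbT ltnW.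
  by apply: contraTneq lt_c; rewrite /box_row => ->; rewrite ltnn.
apply/setP => i; rewrite !inE; apply/existsP/andP => [[b /existsP[b' /and3P[]]]|[i0 di]].
  rewrite !TE => /eqP ei /eqP[ei'] lt_r; rewrite -ei; split=> //=.
  have lt_i : (index (ssval b) w).+1 < size w by rewrite ei -ei' index_mem.
  rewrite /pat (steps_nth _ (ssval b) lt_i) (nth_index _ (inw b)) ei -ei' nth_index //.
have x0 : cell by exact: (0, 0).
have lt_i : i.-1.+1 < size w by rewrite prednK // szw.
have ex v : v < size w -> exists b : box A, ssval b = nth x0 w v.
  move=> lt_v; have h : nth x0 w v \in boxes A by rewrite -(perm_mem pw) mem_nth.
  by exists (SeqSub h).
have [b eb] := ex _ (ltnW lt_i); have [b' eb'] := ex _ lt_i.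
exists b; apply/existsP; exists b'; rewrite !TE eb eb' !index_uniq ?(ltnW lt_i) //.
move: di; rewrite /pat (steps_nth _ x0 lt_i) /below /box_row eb eb' => ->.
by rewrite !prednK // !eqxx.
Qed.

(** Go along the row of [b] to the column of [b'] and then down; convexity supplies the turning
    box. *)
Lemma SYT_mono (T : filling A) (b b' : box A) : is_SYT T ->
  ble (ssval b) (ssval b') -> b != b' -> T b < T b'.
Proof.
case/and4P=> _ _ /forallP hr /forallP hc /andP[le1 le2] ne.
have mS : (box_row b, box_col b') \in boxes A.
  apply: (boxes_convex (ssval_in b) (ssval_in b')); rewrite /ble /= ?leqnn ?andbT //.
pose c : box A := SeqSub mS.
have h1 : (b == c) || (T b < T c).
  have [->//|ne'] := eqVneq b c; have /forallP/(_ c)/implyP -> := hr b => //.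
  rewrite eqxx /= ltn_neqAle le2 andbT; apply: contra ne' => /eqP e.
  by apply/eqP/val_inj; rewrite /= [LHS]surjective_pairing; congr (_, _); exact: e.
have h2 : (c == b') || (T c < T b').
  have [->//|ne'] := eqVneq c b'; have /forallP/(_ b')/implyP -> := hc c => //.
  rewrite eqxx /= ltn_neqAle le1 andbT; apply: contra ne' => /eqP e.
  by apply/eqP/val_inj; rewrite /= [RHS]surjective_pairing; congr (_, _); exact: e.
case/predU1P: h1 => [eb|lt1].
  by move: h2; rewrite -eb (negPf ne).
by case/predU1P: h2 => [<-//|]; exact: ltn_trans.
Qed.

Lemma word_of_SYT (T : filling A) : is_SYT T ->
  exists2 w, linext (boxes A) w & descent_set T = descents_of n (pat w).
Proof.
move=> sT; have /and4P[/forallP T0 /injectiveP Ti _ _] := sT.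
pose r := relpre (fun b : box A => T b : nat) leq.
have r_tr : transitive r by move=> y x z; exact: leq_trans.
pose L := sort r (enum (box A)).
have uL : uniq L by rewrite sort_uniq enum_uniq.
have pL : pairwise (fun b b' => T b < T b') L.
  have : pairwise (fun b b' => (b != b') && r b b') L.
    rewrite pairwise_relI -uniq_pairwise uL -sorted_pairwise //.
    by apply: sort_sorted => x y; exact: leq_total.
  apply: sub_pairwise => b b' /andP[ne]; rewrite /r /= leq_eqVlt => /orP[/eqP e|//].
  by case/eqP: ne; apply/Ti/val_inj.
pose w := map (@ssval _ (boxes A)) L : seq cell.
have lw : linext (boxes A) w.
  apply/andP; split.
    apply: uniq_perm; rewrite ?boxes_uniq ?map_inj_uniq //; first exact: val_inj.
    move=> x; apply/mapP/idP => [[b _ ->]|xA]; first exact: ssval_in.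
    by exists (SeqSub xA); rewrite // mem_sort mem_enum.
  rewrite /linear pairwise_map; apply: sub_pairwise pL => b b' /= lt_b.
  apply/negP => le_b; have ne : b' != b by apply: contraTneq lt_b => ->; rewrite ltnn.
  by have := SYT_mono sT le_b ne; rewrite ltnNge ltnW.
exists w => //; have [T' [_ <- T'E]] := SYT_of_word lw.
(* [T'] numbers the boxes by their place in [L]. So does [T], because its entries in increasing
   order are exactly 1, ..., [n]. *)
suff -> : T = T' by [].
have szL : size L = n.
  have /andP[/perm_size + _] := lw; by rewrite size_map size_boxes.
have eL : map (fun b => T b : nat) L = iota 1 n.
  have sL : sorted ltn (map (fun b => T b : nat) L).
    by rewrite sorted_map; exact: pairwise_sorted.
  apply: (irr_sorted_eq ltn_trans ltnn sL (iota_ltn_sorted _ _)).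
  have [] := uniq_min_size (sorted_uniq ltn_trans ltnn sL) (s2 := iota 1 n) => //.
    by move=> _ /mapP[b _ ->]; rewrite mem_iota T0 add1n ltn_ord.
  by rewrite size_map size_iota szL.
apply/ffunP => b; apply/val_inj; rewrite /= T'E.
have bL : b \in L by rewrite mem_sort mem_enum.
rewrite index_map; last exact: val_inj.
have := congr1 (fun s => nth 0 s (index b L)) eL.
have lt_b : index b L < size L by rewrite index_mem.
have lt_bn : index b L < n by rewrite -[X in _ < X]szL.
by rewrite (nth_map b) // nth_index // nth_iota.
Qed.

End Tableaux.

(** * Quasisymmetric functions *)

Lemma scanl_addn x (s : seq nat) :
  scanl addn x s = [seq x + sumn (take j s) | j <- iota 1 (size s)].
Proof.
elim: s x => //= y s IHs x; rewrite take0 /= addn0; congr (_ :: _).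
by rewrite IHs (iotaDl 1 1) -map_comp; apply: eq_map => j /=; rewrite addnA.
Qed.

Lemma sorted_scanl_addn x (s : seq nat) : 0 \notin s -> path ltn x (scanl addn x s).
Proof.
elim: s x => //= y s IHs x; rewrite inE negb_or eq_sym -lt0n => /andP[y0 /IHs->].
by rewrite -[X in X < _]addn0 ltn_add2l y0.
Qed.

Lemma comp_set_inj n : injective (@comp_set n).
Proof.
move=> a b eab; have /andP[a0 /eqP an] := valP a; have /andP[b0 /eqP bn] := valP b.
(* The parts are recovered as differences of the proper partial sums followed by the total. The
   empty composition has no such final sum, hence the separate case. *)
apply/val_inj; rewrite /=; case: n => [|n] in a b eab a0 an b0 bn *.
  have nil s : 0 \notin s -> sumn s = 0 -> s = [::].
    by move=> /size_le_sumn + e; rewrite e leqn0 => /nilP.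
  by rewrite (nil _ a0 an) (nil _ b0 bn).
pose ps (s : seq nat) := [seq sumn (take j s) | j <- iota 1 (size s).-1].
have psE (s : seq nat) : sumn s = n.+1 -> scanl addn 0 s = rcons (ps s) n.+1.
  case: s => // x s es; rewrite scanl_addn /ps.
  have -> : iota 1 (size (x :: s)) = rcons (iota 1 (size s)) (size s).+1.
    by rewrite -cats1 -[size (x :: s)]addn1 iotaD.
  rewrite map_rcons; congr (rcons _ _); by rewrite add0n take_oversize // es.
have sps (s : seq nat) : 0 \notin s -> sumn s = n.+1 -> path ltn 0 (rcons (ps s) n.+1).
  by move=> s0 es; rewrite -psE //; exact: sorted_scanl_addn.
have lt_ps (s : seq nat) x : 0 \notin s -> sumn s = n.+1 -> x \in ps s -> x < n.+1.
  move=> s0 es xs; have := sps s s0 es; rewrite (path_sortedE ltn_trans) => /andP[_].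
  rewrite (sorted_pairwise ltn_trans) pairwise_rcons => /andP[/allP/(_ x xs)].
  by [].
suff e : ps a = ps b.
  apply: (can_inj (scanlK (f := fun x y => y - x) (g := addn) _ 0)).
    by move=> x y; rewrite addKn.
  by rewrite !psE // e.
have ss (s : seq nat) : 0 \notin s -> sumn s = n.+1 -> sorted ltn (ps s).
  move=> s0 es; have := sps s s0 es; rewrite (path_sortedE ltn_trans) => /andP[_].
  by rewrite !(sorted_pairwise ltn_trans) pairwise_rcons => /andP[_].
apply: (irr_sorted_eq ltn_trans ltnn (ss _ a0 an) (ss _ b0 bn)) => x.
have [lt_x|le_x] := ltnP x n.+1.
  by move/setP/(_ (Ordinal lt_x)): eab; rewrite !inE.
by apply/idP/idP => [/(lt_ps _ _ a0 an)|/(lt_ps _ _ b0 bn)]; rewrite ltnNge le_x.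
Qed.

(** The leading monomial of M_b; no other M of the same degree contains it. *)
Definition comp_monomial n (b : composition n) : monomial :=
  [fsfun i in [fset x in iota 0 (size b)]%fset => nth 0 b i | 0].

Lemma exponents_comp_monomial n (b : composition n) :
  exponents (comp_monomial b) = b.
Proof.
have mE i : comp_monomial b i = nth 0 b i.
  rewrite fsfunE inE /= mem_iota add0n /=; case: ltnP => // le_i.
  by rewrite nth_default.
have b0 : 0 \notin parts b by have /andP[] := valP b.
have -> : exponents (comp_monomial b) = [seq nth 0 b i | i <- iota 0 (size b)].
  rewrite /exponents (_ : sort leq _ = iota 0 (size b)); first exact: eq_map.
  apply: (sorted_eq leq_trans anti_leq); first exact: sort_sorted leq_total _.
    exact: iota_sorted.
  rewrite perm_sort; apply: uniq_perm; rewrite ?iota_uniq ?fset_uniq // => i.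
  rewrite mem_finsupp mE mem_iota add0n /=; case: ltnP => [lt_i|le_i]; last by rewrite nth_default.
  by apply: contraNneq b0 => <-; exact: mem_nth.
exact: mkseq_nth.
Qed.

Lemma fundamental_comp_monomial n (a b : composition n) :
  fundamental_qsym a (comp_monomial b) = ((comp_set a \subset comp_set b)%:R)%R.
Proof.
rewrite /fundamental_qsym /monomial_qsym exponents_comp_monomial.
rewrite big_mkcond (bigD1 b) //= eqxx big1 ?addr0; first by case: (_ \subset _).
move=> b' ne; case: ifP => // _.
by rewrite (_ : (parts b == parts b') = (b == b')) // eq_sym (negPf ne).
Qed.

(** At [comp_monomial b] only those F_a with [comp_set a] inside [comp_set b] contribute. The system
    is triangular for inclusion, so the coefficients are determined by induction on the size of
    [comp_set b]. *)
Lemma F_expansion_uniq n (f : power_series) (c c' : composition n -> int) :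
  F_expansion f c -> F_expansion f c' -> c =1 c'.
Proof.
move=> fc fc' b; have [k le_k] := ubnP #|comp_set b|.
elim: k b le_k => // k IHk b le_k.
have := fc (comp_monomial b); rewrite fc' (bigD1 b) //= [in RHS](bigD1 b) //=.
rewrite fundamental_comp_monomial subxx !mulr1.
rewrite (eq_bigr (fun a => c a * fundamental_qsym a (comp_monomial b))%R).
  by move/addIr.
move=> a ne; rewrite fundamental_comp_monomial.
have [sub|] := boolP (comp_set a \subset comp_set b); last by rewrite !mulr0.
rewrite IHk // (leq_trans _ (_ : #|comp_set b| <= k)) //.
apply: proper_card; rewrite properEneq sub andbT.
by apply: contra ne => /eqP/comp_set_inj->.
Qed.

(** * The F-support in terms of words *)

Section Support.

Variables (n : nat) (A : skew_shape n).

Definition SYT_count (a : composition n) : nat :=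
  #|[pred T : filling A | is_SYT T && (descent_comp T == a)]|.

Lemma skew_schur_expansion : F_expansion (skew_schur A) (fun a => (SYT_count a)%:R%R).
Proof.
move=> m; rewrite /skew_schur (partition_big (@descent_comp n A) predT) //=.
apply: eq_bigr => a _; rewrite (eq_bigr (fun=> fundamental_qsym a m)).
  by rewrite sumr_const mulr_natl.
by move=> T /andP[_ /eqP->].
Qed.

Lemma F_supportP (a : composition n) :
  F_support A a <-> exists2 T : filling A, is_SYT T & descent_comp T = a.
Proof.
split=> [[c fc]|[T sT eT]].
  rewrite (F_expansion_uniq fc skew_schur_expansion) ltr0n => /card_gt0P[T].
  by rewrite inE => /andP[sT /eqP eT]; exists T.
exists (fun a => (SYT_count a)%:R%R); first exact: skew_schur_expansion.
by rewrite ltr0n; apply/card_gt0P; exists T; rewrite inE sT eT /=.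
Qed.

Lemma F_multiplicity_free_inj (T T' : filling A) : F_multiplicity_free A ->
  is_SYT T -> is_SYT T' -> descent_comp T = descent_comp T' -> T = T'.
Proof.
case=> c fc hc sT sT' e; have : SYT_count (descent_comp T') <= 1.
  have := F_expansion_uniq fc skew_schur_expansion (descent_comp T').
  by case: (hc (descent_comp T')) => -> /eqP; rewrite eq_sym ?pnatr_eq0 ?pnatr_eq1 => /eqP->.
by move/card_le1P/(_ T'); rewrite !inE sT' eqxx => /(_ isT T); rewrite !inE sT e eqxx => /esym/eqP.
Qed.

Lemma descent_set_gt0 (T : filling A) (i : 'I_n) : is_SYT T -> i \in descent_set T -> 0 < i.
Proof.
case/and4P=> /forallP T0 _ _ _; rewrite inE => /existsP[b /existsP[b' /and3P[/eqP<- _ _]]].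
exact: T0.
Qed.

Lemma descent_comp_set (T : filling A) : is_SYT T ->
  comp_set (descent_comp T) = descent_set T.
Proof. by move=> sT; apply: set_compK => i; exact: descent_set_gt0. Qed.

Lemma mfree_boxes : F_multiplicity_free A -> mfree (boxes A).
Proof.
move=> mA w w' lw lw' eqp.
have [T [sT dT TE]] := SYT_of_word lw; have [T' [sT' dT' TE']] := SYT_of_word lw'.
have eT : T = T'.
  apply: F_multiplicity_free_inj => //; apply: comp_set_inj.
  by rewrite !descent_comp_set // dT dT' eqp.
have /andP[pw linw] := lw; have /andP[pw' linw'] := lw'.
have uw := linear_uniq linw; have uw' := linear_uniq linw'.
have szw : size w' = size w by rewrite (perm_size pw) (perm_size pw').
apply: (@eq_from_nth _ (0, 0)) => // i lt_i.
have xA : nth (0, 0) w i \in boxes A by rewrite -(perm_mem pw) mem_nth.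
have := TE (SeqSub xA); rewrite eT TE' /= index_uniq // => -[ei].
by rewrite -[X in _ = nth _ _ X]ei nth_index // (perm_mem pw').
Qed.

Lemma F_support_occurs (a : composition n) : F_support A a <->
  exists2 p, occurs (boxes A) p & comp_set a = descents_of n p.
Proof.
rewrite F_supportP; split=> [[T sT <-]|[p [w lw <-] ea]].
  have [w lw dT] := word_of_SYT sT; exists (pat w); first by exists w.
  by rewrite descent_comp_set.
have [T [sT dT _]] := SYT_of_word lw; exists T => //.
by apply: comp_set_inj; rewrite descent_comp_set // dT ea.
Qed.

Lemma occurs_comp p : occurs (boxes A) p ->
  exists a : composition n, comp_set a = descents_of n p.
Proof.
case=> w lw <-; have [T [sT dT _]] := SYT_of_word lw.
by exists (descent_comp T); rewrite descent_comp_set.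
Qed.

End Support.

Lemma size_occurs n (A : skew_shape n) p : occurs (boxes A) p -> size p = n.-1.
Proof. by case=> w /andP[/perm_size sw _] <-; rewrite size_pat sw size_boxes. Qed.

Lemma F_support_sub n (A B : skew_shape n) :
  (forall a : composition n, F_support B a -> F_support A a) <->
  (forall p, occurs (boxes B) p -> occurs (boxes A) p).
Proof.
split=> [h p op|h a].
  have [a ea] := occurs_comp op.
  have /h/F_support_occurs[q oq] : F_support B a by apply/F_support_occurs; exists p.
  by rewrite ea => /descents_of_inj ->; rewrite ?(size_occurs op) ?(size_occurs oq).
by case/F_support_occurs => p /h op ea; apply/F_support_occurs; exists p.
Qed.

Theorem corollary6p4 (n : nat) (A B : skew_shape n)
    (hA : F_multiplicity_free A) (hB : F_multiplicity_free B) :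
  (forall a : composition n, F_support B a -> F_support A a) <->
  (forall k : nat, 1 <= k -> dominated (rows A k) (rows B k)).
Proof.
rewrite F_support_sub dominated_rc.
have [cA cB] := (@boxes_convex n A, @boxes_convex n B).
have [uA uB] := (boxes_uniq A, boxes_uniq B).
have szAB : size (boxes A) = size (boxes B) by rewrite !size_boxes.
split=> [h|h p]; first exact: occurs_rc cA cB uB szAB h.
exact: occurs_sub cA uA (mfree_boxes hA) cB uB (mfree_boxes hB) szAB h.
Qed.
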